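(* Let $d\ge2$ and let $F:\overline{D}^2\to\mathbb{C}^2$ be a complex horseshoe of degree $d$. Then there exists a homeomorphism $\Phi:K\to\mathcal{S}_d$ which conjugates $F$ to the full shift $\tau_d$, i.e. $\Phi\circ F|_K=\tau_d\circ\Phi$.
   Context: $D\subset\mathbb{C}$ is the open unit disc and $\pi_1,\pi_2:\mathbb{C}^2\to\mathbb{C}$ are the coordinate projections. Put $B=D^2$, $\partial B_H=\overline{D}\times\partial\overline{D}$, $\partial B_V=\partial\overline{D}\times\overline{D}$, and for $x,y\in D$, $H_y=D\times\{y\}$, $V_x=\{x\}\times D$. Quasi-Hénon-like mapping of degree $d\ge2$ on $\overline{B}$: a map $F:\overline{B}\to\mathbb{C}^2$ for which there is $G:\overline{B}\to\mathbb{C}^2$ such that: (i) $F$ and $G$ are injective and continuous on $\overline{B}$ and analytic on $B$; (ii) $F\circ G=\mathrm{Id}$ and $G\circ F=\mathrm{Id}$ wherever these make sense ($G$ is then denoted $F^{-1}$); (iii) either (a) $F(\overline{B})\cap\partial B_H=\emptyset$ and $\overline{B}\cap F(\partial B_V)=\emptyset$ ($F$ is called horizontal), or (b) $\overline{B}\cap F(\partial B_H)=\emptyset$ and $F(\overline{B})\cap\partial B_V=\emptyset$ ($F$ is called vertical); (iv) in case (a), the proper map $\pi_1:F(H_y)\cap B\to D$ has degree $d$ (it does not depend on $y\in D$); in case (b), the proper map $\pi_2:F(V_x)\cap B\to D$ has degree $d$ (it does not depend on $x\in D$). Iterates: $F^{\circ m}(B)$ (resp. $F^{\circ -m}(B)$)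 is the set of all points $F^{\circ m}(z)$ (resp. $(F^{-1})^{\circ m}(z)$), $z\in B$, for which the iterate is defined. Complex horseshoe of degree $d$: a quasi-Hénon-like mapping $F$ of degree $d$ such that for all integers $n>0$, if $F$ is horizontal, the projections $\pi_1:\bigcap_{0\le m\le n}F^{\circ m}(B)\to D$ and $\pi_2:\bigcap_{0\le m\le n}F^{\circ -m}(B)\to D$ are trivial fibrations with fibers disjoint unions of $d^n$ discs; if $F$ is vertical, the same holds for $\pi_2:\bigcap_{0\le m\le n}F^{\circ m}(B)\to D$ and $\pi_1:\bigcap_{0\le m\le n}F^{\circ -m}(B)\to D$. Invariant sets: $K_+=\{z\in B: F^{\circ n}(z)\in B\text{ for all }n>0\}$, $K_-=\{z\in B: F^{\circ -n}(z)\in B\text{ for all }n>0\}$, $K=K_+\cap K_-$. Symbol space: $\mathcal{S}_d=\{0,1,\dots,d-1\}^{\mathbb{Z}}$ with the product topology, and $\tau_d:\mathcal{S}_d\to\mathcal{S}_d$ is the (two-sided) shift on $d$ symbols, $(\tau_d s)_n=s_{n+1}$. *)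

(* Defs.v *)
From HB Require Import structures.
From mathcomp Require Import all_boot all_order all_algebra.
From mathcomp Require Import complex.
From mathcomp Require Import all_classical all_reals all_analysis.

Set Implicit Arguments.
Unset Strict Implicit.
Unset Printing Implicit Defensive.

Import Order.TTheory GRing.Theory Num.Theory.
Export numFieldNormedType.Exports.

Local Open Scope classical_set_scope.
Local Open Scope ring_scope.

(* R[i] seen as a numClosedFieldType, so that it inherits the topology and the
   normed module structure (over itself) that MathComp-Analysis attaches to
   such fields; differentiability over it is complex differentiability. *)
Definition Cplx (R : realType) : numClosedFieldType := R[i]%C.

Section Topology.

(* Functions are total; only their values on the given sets matter, and
   continuity is continuity for the induced topologies. *)
Definition homeomorphism (T U : topologicalType) (A : set T) (B : set U)
    (f : T -> U) : Prop :=
  exists g : U -> T,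
    [/\ {within A, continuous f}, {within B, continuous g},
        (forall x, A x -> B (f x) /\ g (f x) = x) &
        (forall y, B y -> A (g y) /\ f (g y) = y)].

Definition proper_map (T U : topologicalType) (X : set T) (Y : set U)
    (p : T -> U) : Prop :=
  [/\ {within X, continuous p}, (forall x, X x -> Y (p x)) &
      forall A : set U, A `<=` Y -> compact A -> compact (X `&` p @^-1` A)].

Definition trivial_fibration (T U V : topologicalType)
    (X : set T) (Y : set U) (p : T -> U) (Z : set V) : Prop :=
  exists h : T -> U * V,
    homeomorphism X (Y `*` Z) h /\ (forall x, X x -> (h x).1 = p x).

End Topology.

Section Bidisc.
Variable R : realType.
Local Notation C := (Cplx R).

Definition disc : set C := [set z | `|z| < 1].
Definition closed_disc : set C := [set z | `|z| <= 1].
Definition circle : set C := [set z | `|z| = 1].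

Definition bidisc : set (C * C) := disc `*` disc.
Definition closed_bidisc : set (C * C) := closed_disc `*` closed_disc.
Definition boundary_H : set (C * C) := closed_disc `*` circle.
Definition boundary_V : set (C * C) := circle `*` closed_disc.

(* The local multiplicity e of f at x: f z - f x = (z - x)^e g z near x, with
   g holomorphic near x and g x nonzero. *)
Definition multiplicity_at (f : C -> C) (x : C) (e : nat) : Prop :=
  exists g : C -> C,
    [/\ \forall z \near x, derivable g z 1, g x != 0 &
        \forall z \near x, f z = f x + (z - x) ^+ e * g z].

(* f : U -> D takes every value w in D exactly d times, with multiplicity. *)
Definition fibers_count (f : C -> C) (U : set C) (d : nat) : Prop :=
  forall w, disc w ->
    exists (s : seq C) (e : C -> nat),
      [/\ uniq s, (forall x, x \in s <-> U x /\ f x = w),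
          (forall x, x \in s -> multiplicity_at f x (e x)) &
          (\sum_(x <- s) e x)%N = d].

(* The map p : F(sigma(D)) n B -> D is proper of degree d, for an injective
   holomorphic sigma : D -> B. The complex structure of the curve
   F(sigma(D)) n B is the one for which t |-> F (sigma t) is a global
   coordinate on it, so multiplicities are computed in t. *)
Definition slice_degree (F : C * C -> C * C) (sigma : C -> C * C)
    (p : C * C -> C) (d : nat) : Prop :=
  proper_map (F @` (sigma @` disc) `&` bidisc) disc p /\
  fibers_count (fun t => p (F (sigma t)))
    [set t | disc t /\ bidisc (F (sigma t))] d.

Definition horizontal (F : C * C -> C * C) : Prop :=
  F @` closed_bidisc `&` boundary_H = set0 /\
  closed_bidisc `&` F @` boundary_V = set0.

Definition vertical (F : C * C -> C * C) : Prop :=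
  closed_bidisc `&` F @` boundary_H = set0 /\
  F @` closed_bidisc `&` boundary_V = set0.

Definition regular_on_bidisc (F : C * C -> C * C) : Prop :=
  [/\ set_inj closed_bidisc F, {within closed_bidisc, continuous F} &
      forall z, bidisc z -> differentiable F z].

(* F and G are maps on the closed bidisc (their values elsewhere are
   irrelevant); G plays the role of the inverse of F. *)
Definition quasi_henon_like (d : nat) (F G : C * C -> C * C) : Prop :=
  [/\ (2 <= d)%N,
      regular_on_bidisc F /\ regular_on_bidisc G,
      (forall z, closed_bidisc z -> closed_bidisc (G z) -> F (G z) = z),
      (forall z, closed_bidisc z -> closed_bidisc (F z) -> G (F z) = z) &
      (horizontal F /\
         forall y, disc y -> slice_degree F (fun x => (x, y)) fst d) \/
      (vertical F /\
         forall x, disc x -> slice_degree F (fun y => (x, y)) snd d)].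

(* F^m(B): since F is only defined on the closed bidisc, the m-th iterate is
   defined at z iff the previous ones, from the 0-th on, lie there. *)
Definition iter_image (F : C * C -> C * C) (m : nat) : set (C * C) :=
  [set w | exists z, [/\ bidisc z,
     (forall i, (i < m)%N -> closed_bidisc (iter i F z)) & iter m F z = w]].

Definition iter_images (F : C * C -> C * C) (n : nat) : set (C * C) :=
  \bigcap_(m in [set m | (m <= n)%N]) iter_image F m.

Definition disjoint_discs (k : nat) : set (discrete_topology 'I_k * C) :=
  setT `*` disc.

Definition complex_horseshoe (d : nat) (F G : C * C -> C * C) : Prop :=
  quasi_henon_like d F G /\
  forall n : nat, (0 < n)%N ->
    (horizontal F ->
       trivial_fibration (iter_images F n) disc fst
         (@disjoint_discs (d ^ n)) /\
       trivial_fibration (iter_images G n) disc snd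
         (@disjoint_discs (d ^ n))) /\
    (vertical F ->
       trivial_fibration (iter_images F n) disc snd
         (@disjoint_discs (d ^ n)) /\
       trivial_fibration (iter_images G n) disc fst
         (@disjoint_discs (d ^ n))).

Definition K_half (F : C * C -> C * C) : set (C * C) :=
  [set z | bidisc z /\ forall n, (0 < n)%N -> bidisc (iter n F z)].

Definition K_inv (F G : C * C -> C * C) : set (C * C) :=
  K_half F `&` K_half G.

End Bidisc.

Definition symbol_space (d : nat) : topologicalType :=
  {ptws int -> discrete_topology 'I_d}.

Definition full_shift (d : nat) (s : symbol_space d) : symbol_space d :=
  fun n : int => s (n + 1).

(* Main.v *)
Require Import Defs.
From mathcomp Require Import all_boot all_order all_algebra.
From mathcomp Require Import complex ring lra zify.
From mathcomp Require Import all_classical all_reals all_analysis.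

Set Implicit Arguments.
Unset Strict Implicit.
Unset Printing Implicit Defensive.

Import Order.TTheory GRing.Theory Num.Theory.

Local Open Scope classical_set_scope.
Local Open Scope ring_scope.

(** Let F be horizontal; the vertical case follows by exchanging coordinates.
    The fibration over B n F(B) cuts it into d pieces, and connectedness of the
    pieces of B n G(B) shows that every horizontal slice H_y meets the preimage
    of every piece. On the part of H_y sent into one piece, pi_1 o F is open and
    proper, hence onto D; as the total degree is d, each vertical disc then meets
    the image of H_y exactly once in each piece, with multiplicity one. Hence the
    i-th branch of F has the cross form F (A_i (x, y), y) = (x, B_i (x, y)) with
    A_i, B_i holomorphic from D^2 to a disc of radius r < 1, and orbits with
    itinerary s are the solutions of x_n = A_(s_(n+1)) (x_(n+1), y_n),
    y_(n+1) = B_(s_(n+1)) (x_(n+1), y_n). By Schwarz-Pick these maps contract the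
    pseudo-hyperbolic distance by 2r/(1+r^2), so each itinerary has exactly one
    orbit, depending continuously on it.

    Differentiability is only assumed pointwise, so the maximum principle is
    obtained from Goursat's lemma, applied in polar coordinates. *)

(** * Goursat on real rectangles *)

(** The radius r comes from compactness: horizontality keeps z.1 and (F z).2 off the unit circle as
    long as z and F z lie in the closed bidisc. F stretches horizontally and squeezes vertically;
    its cross form contracts in both variables, because the abscissa is determined by the future and
    the ordinate by the past. An orbit with prescribed symbols is thus a fixed point of a
    contraction on bi-infinite sequences, whose n-th term looks at both neighbours. The symbol s_n
    names the piece of B n F(B) that contains the n-th point, so the step from n to n+1 carries
    s_(n+1).

    Holomorphy of A_i and B_i is only asked along analytic discs: two pairs of points at
    pseudo-hyperbolic distance at most k are joined by two discs run with the same parameter, and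
    the one-variable Schwarz-Pick lemma is applied to the composite. All of it rests on one
    inequality for the mean of a real part over a circle: the maximum principle, openness through
    1/(f - w), and Schwarz's lemma, where h(z)/z is known to be continuous at 0 but not yet
    differentiable there. *)

Section Goursat.
Variable R : realType.
Implicit Types (phi psi : R -> R) (u v : R -> R -> R).

(* Only meaningful for A <= x: the integral over an empty interval is 0. *)
Definition prim (A : R) phi (x : R) : R :=
  \int[lebesgue_measure]_(t in `[A, x]) phi t.

Lemma is_derive_prim (A : R) phi (x : R) : continuous phi -> A < x ->
  is_derive x 1 (prim A phi) (phi x).
Proof.
move=> cphi Ax.
(* Integrating up to x + 1 makes x an interior point of the interval. *)
have [||||d1 d2] := @continuous_FTC1_closed R phi A x (x + 1).
- by rewrite ltrDl.
- apply: continuous_compact_integrable; first exact: segment_compact.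
  exact: continuous_subspaceT.
- exact: Ax.
- exact: cphi.
- by apply: DeriveDef; [exact: d1|rewrite -derive1E; exact: d2].
Qed.

(** Mean value theorem for f - g. Integrals are estimated below by comparing primitives in this
    way. *)
Lemma derive_sub_le (f g f' g' : R -> R) (a b M : R) : a <= b ->
  (forall x, a <= x <= b -> is_derive x 1 f (f' x)) ->
  (forall x, a <= x <= b -> is_derive x 1 g (g' x)) ->
  (forall x, a <= x <= b -> f' x - g' x <= M) ->
  (f b - f a) - (g b - g a) <= M * (b - a).
Proof.
move=> ab df dg fgM.
have dfg x : a <= x <= b -> is_derive x 1 (f \- g) (f' x - g' x).
  by move=> xab; apply: is_deriveB; [exact: df|exact: dg].
have [x||] := @MVT_segment R (f \- g) (fun x => f' x - g' x) a b ab.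
- by rewrite in_itv/= => /andP[ax xb]; apply: dfg; rewrite !ltW.
- apply: derivable_within_continuous => x; rewrite in_itv/= => xab.
  by have [] := dfg _ xab.
- move=> c; rewrite in_itv/= => cab /= E.
  have -> : f b - f a - (g b - g a) = f b - g b - (f a - g a) by ring.
  by rewrite E ler_wpM2r ?subr_ge0// fgM.
Qed.

Lemma is_derive_quadratic (al be x : R) :
  is_derive x 1 (fun t : R => al * t + be / 2 * (t * t)) (al + be * x).
Proof.
apply: is_derive_eq.
by rewrite /GRing.scale/=; field.
Qed.

Lemma prim_affine_le (A a b al be M : R) phi : continuous phi -> A < a ->
  a <= b -> (forall x, a <= x <= b -> `|phi x - (al + be * x)| <= M) ->
  `|prim A phi b - prim A phi a -
    (al * b + be / 2 * (b * b) - (al * a + be / 2 * (a * a)))| <= M * (b - a).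
Proof.
move=> cphi Aa ab phiM.
have d1 x : a <= x <= b -> is_derive x 1 (prim A phi) (phi x).
  by move=> /andP[ax xb]; apply: is_derive_prim => //; exact: lt_le_trans ax.
have d2 x : a <= x <= b ->
  is_derive x 1 (fun t : R => al * t + be / 2 * (t * t)) (al + be * x).
  by move=> _; exact: is_derive_quadratic.
rewrite ler_norml; apply/andP; split.
  rewrite lerNl opprB; apply: (derive_sub_le ab d2 d1) => x /phiM.
  by rewrite distrC; apply: le_trans; exact: ler_norm.
by apply: (derive_sub_le ab d1 d2) => x /phiM; apply: le_trans; exact: ler_norm.
Qed.

(* The integral of v ds + u dt round the rectangle [a, b] x [c, d]. *)
Definition rect_int (A : R) u v (a b c d : R) : R :=
  (prim A (v^~ c) b - prim A (v^~ c) a) + (prim A (u b) d - prim A (u b) c)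
  - (prim A (v^~ d) b - prim A (v^~ d) a) - (prim A (u a) d - prim A (u a) c).

(** The form v ds + u dt is the imaginary part of (u + i v) (ds + i dt). The coefficient p common to
    both expansions is the Cauchy-Riemann equation that closes it, so the affine parts integrate to
    0 and what remains is at most e times the perimeter. *)
Lemma rect_int_le (A a b c d : R) u v (s0 t0 p q r e : R) :
  (forall s, continuous (u s)) -> (forall t, continuous (v^~ t)) ->
  A < a -> A < c -> a <= b -> c <= d ->
  (forall s t, a <= s <= b -> c <= t <= d ->
    `|u s t - u s0 t0 - p * (s - s0) - q * (t - t0)| <= e /\
    `|v s t - v s0 t0 - r * (s - s0) - p * (t - t0)| <= e) ->
  `|rect_int A u v a b c d| <= 2 * e * ((b - a) + (d - c)).
Proof.
move=> cu cv Aa Ac ab cd H.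
have av t : c <= t <= d ->
  `|prim A (v^~ t) b - prim A (v^~ t) a -
    ((v s0 t0 - r * s0 + p * (t - t0)) * b + r / 2 * (b * b) -
     ((v s0 t0 - r * s0 + p * (t - t0)) * a + r / 2 * (a * a)))| <= e * (b - a).
  move=> tcd; apply: prim_affine_le => // s sab.
  have [_] := H _ _ sab tcd; congr (`|_| <= _); ring.
have au s : a <= s <= b ->
  `|prim A (u s) d - prim A (u s) c -
    ((u s0 t0 - q * t0 + p * (s - s0)) * d + q / 2 * (d * d) -
     ((u s0 t0 - q * t0 + p * (s - s0)) * c + q / 2 * (c * c)))| <= e * (d - c).
  move=> sab; apply: prim_affine_le => // t tcd.
  have [+ _] := H _ _ sab tcd; congr (`|_| <= _); ring.
have aab : a <= a <= b by rewrite lexx.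
have bab : a <= b <= b by rewrite lexx andbT.
have ccd : c <= c <= d by rewrite lexx.
have dcd : c <= d <= d by rewrite lexx andbT.
move: (av _ ccd) (av _ dcd) (au _ aab) (au _ bab).
rewrite /rect_int !ler_norml.
by move=> /andP[? ?] /andP[? ?] /andP[? ?] /andP[? ?]; apply/andP; split; lra.
Qed.

Lemma rect_int_split (A a b c d m n : R) u v :
  rect_int A u v a b c d =
  rect_int A u v a m c n + rect_int A u v m b c n +
  rect_int A u v a m n d + rect_int A u v m b n d.
Proof. by rewrite /rect_int; ring. Qed.

Lemma nested_itv (a b : nat -> R) : (forall n, a n <= a n.+1) ->
  (forall n, b n.+1 <= b n) -> (forall n, a n <= b n) ->
  exists x, forall n, a n <= x <= b n.
Proof.
move=> ia ib ab.
have amono m n : (m <= n)%N -> a m <= a n.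
  by move=> mn; apply: (@homo_leq _ a (fun x y => x <= y)) => //; exact: le_trans.
have bmono m n : (m <= n)%N -> b n <= b m.
  move=> mn; apply: (@homo_leq _ b (fun x y => y <= x)) => //.
  by move=> ? ? ? h1 h2; exact: le_trans h2 h1.
have aub n : ubound (range a) (b n).
  move=> _ [m _ <-]; case: (leqP m n) => [mn|/ltnW nm].
    exact: le_trans (amono _ _ mn) (ab n).
  exact: le_trans (ab m) (bmono _ _ nm).
exists (sup (range a)) => n; apply/andP; split.
  by apply: ub_le_sup; [exists (b 0%N); exact: aub|exists n].
by apply: ge_sup => //; exists (a 0%N), 0%N.
Qed.

Lemma exists_div_exp2_lt (w e : R) : 0 < e -> exists n : nat, w / 2 ^+ n < e.
Proof.
move=> e0; have [n nw] : exists n : nat, w / e < n%:R.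
  exists (Num.truncn (Num.max 0 (w / e))).+1.
  by apply: le_lt_trans (truncnS_gt _); rewrite le_max lexx orbT.
exists n; rewrite ltr_pdivrMr ?exprn_gt0// mulrC -ltr_pdivrMr//.
apply: (lt_trans nw).
by rewrite -natrX ltr_nat ltn_expl.
Qed.

(* Bisection: the ratio |integral|/area never decreases along a well-chosen
   nested sequence of quarters, but tends to 0 at the limit point. *)
Lemma goursat_rect (A a b c d : R) u v :
  (forall s, continuous (u s)) -> (forall t, continuous (v^~ t)) ->
  A < a -> A < c -> a < b -> c < d ->
  (forall s0 t0, a <= s0 <= b -> c <= t0 <= d -> exists p q r : R,
    forall e : R, 0 < e -> exists2 de : R, 0 < de & forall s t,
    `|s - s0| < de -> `|t - t0| < de ->
    `|u s t - u s0 t0 - p * (s - s0) - q * (t - t0)|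
       <= e * (`|s - s0| + `|t - t0|) /\
    `|v s t - v s0 t0 - r * (s - s0) - p * (t - t0)|
       <= e * (`|s - s0| + `|t - t0|)) ->
  rect_int A u v a b c d = 0.
Proof.
move=> cu cv Aa Ac ab cd D; apply/eqP/negPn/negP => J0.
pose w n := (b - a) / 2 ^+ n; pose h n := (d - c) / 2 ^+ n.
have w_gt0 n : 0 < w n by rewrite divr_gt0 ?exprn_gt0 ?subr_gt0.
have h_gt0 n : 0 < h n by rewrite divr_gt0 ?exprn_gt0 ?subr_gt0.
have wS n : w n = w n.+1 + w n.+1 by rewrite /w exprS; field; rewrite expf_neq0.
have hS n : h n = h n.+1 + h n.+1 by rewrite /h exprS; field; rewrite expf_neq0.
have [eta eta0 etaE] : exists2 eta : R, 0 < eta &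
    eta * (w 0%N * h 0%N) = `|rect_int A u v a b c d|.
  exists (`|rect_int A u v a b c d| / (w 0%N * h 0%N)).
    by apply: divr_gt0; [rewrite normr_gt0|apply: mulr_gt0].
  by rewrite divfK// mulf_neq0// lt0r_neq0.
(* A pair p stands for the rectangle of level n with lower left corner p. *)
pose bad n (p : R * R) := eta * (w n * h n) <=
  `|rect_int A u v p.1 (p.1 + w n) p.2 (p.2 + h n)|.
pose sub n (p q : R * R) := [/\ p.1 <= q.1, p.2 <= q.2,
  q.1 + w n.+1 <= p.1 + w n & q.2 + h n.+1 <= p.2 + h n].
(* If no quarter were bad, the four integrals would add up to less than 4 eta times the area of a
   quarter. The implication sits under the existential so that choice gives a total function. *)
have step n p : exists q, bad n p -> bad n.+1 q /\ sub n p q.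
  have [badp|] := pselect (bad n p); last by exists p.
  apply: contrapT => /forallNP nq.
  have {}nq q : sub n p q -> ~ bad n.+1 q.
    by move=> spq bq; apply: (nq q) => _.
  have w1 := w_gt0 n.+1; have h1 := h_gt0 n.+1.
  have q1 : p.1 + w n = p.1 + w n.+1 + w n.+1 by rewrite wS addrA.
  have q2 : p.2 + h n = p.2 + h n.+1 + h n.+1 by rewrite hS addrA.
  have := nq (p.1, p.2); have := nq (p.1 + w n.+1, p.2).
  have := nq (p.1, p.2 + h n.+1); have := nq (p.1 + w n.+1, p.2 + h n.+1).
  rewrite /sub /bad/= !q1 !q2 => n4 n3 n2 n1; move: badp.
  rewrite /bad q1 q2.
  rewrite (rect_int_split A _ _ _ _ (p.1 + w n.+1) (p.2 + h n.+1)).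
  have {}n1 : `|rect_int A u v p.1 (p.1 + w n.+1) p.2 (p.2 + h n.+1)|
      < eta * (w n.+1 * h n.+1).
    by rewrite ltNge; apply/negP => B; apply: (n1 _ B); split;
      rewrite ?lexx ?lerDl ?(ltW w1) ?(ltW h1).
  have {}n2 : `|rect_int A u v (p.1 + w n.+1) (p.1 + w n.+1 + w n.+1) p.2 (p.2 + h n.+1)|
      < eta * (w n.+1 * h n.+1).
    by rewrite ltNge; apply/negP => B; apply: (n2 _ B); split;
      rewrite ?lexx ?lerDl ?(ltW w1) ?(ltW h1).
  have {}n3 : `|rect_int A u v p.1 (p.1 + w n.+1) (p.2 + h n.+1) (p.2 + h n.+1 + h n.+1)|
      < eta * (w n.+1 * h n.+1).
    by rewrite ltNge; apply/negP => B; apply: (n3 _ B); split;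
      rewrite ?lexx ?lerDl ?(ltW w1) ?(ltW h1).
  have {}n4 : `|rect_int A u v (p.1 + w n.+1) (p.1 + w n.+1 + w n.+1)
      (p.2 + h n.+1) (p.2 + h n.+1 + h n.+1)| < eta * (w n.+1 * h n.+1).
    by rewrite ltNge; apply/negP => B; apply: (n4 _ B); split;
      rewrite ?lexx ?lerDl ?(ltW w1) ?(ltW h1).
  move=> bp; have := le_trans bp (le_trans (ler_normD _ _)
    (lerD (le_trans (ler_normD _ _) (lerD (ler_normD _ _) (lexx _))) (lexx _))).
  rewrite (wS n) (hS n).
  have -> : eta * ((w n.+1 + w n.+1) * (h n.+1 + h n.+1)) =
    4 * (eta * (w n.+1 * h n.+1)) by ring.
  lra.
have [g gP] : exists g : nat -> R * R -> R * R,
    forall n p, bad n p -> bad n.+1 (g n p) /\ sub n p (g n p).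
  have /choice[g gP] : forall n, exists gn : R * R -> R * R,
    forall p, bad n p -> bad n.+1 (gn p) /\ sub n p (gn p).
    by move=> n; have /choice[gn gnP] := step n; exists gn.
  by exists g.
pose s := fix s n := if n is m.+1 then g m (s m) else (a, c).
have sbad n : bad n (s n).
  elim: n => [|n IH]; last by have [] := gP _ _ IH.
  rewrite /bad/= etaE.
  have -> : a + w 0%N = b by rewrite /w expr0 divr1 addrC subrK.
  by have -> : c + h 0%N = d by rewrite /h expr0 divr1 addrC subrK.
have ssub n : sub n (s n) (s n.+1) by have [] := gP _ _ (sbad n).
have [s0 s0P] := @nested_itv (fun n => (s n).1) (fun n => (s n).1 + w n)
  (fun n => let: And4 h _ _ _ := ssub n in h)
  (fun n => let: And4 _ _ h _ := ssub n in h)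
  (fun n => ltW (ltr_pwDr (w_gt0 n) (lexx _))).
have [t0 t0P] := @nested_itv (fun n => (s n).2) (fun n => (s n).2 + h n)
  (fun n => let: And4 _ h _ _ := ssub n in h)
  (fun n => let: And4 _ _ _ h := ssub n in h)
  (fun n => ltW (ltr_pwDr (h_gt0 n) (lexx _))).
have aw : a + w 0%N = b by rewrite /w expr0 divr1 addrC subrK.
have ch : c + h 0%N = d by rewrite /h expr0 divr1 addrC subrK.
have as_ n : a <= (s n).1 /\ c <= (s n).2.
  elim: n => [|n [IH1 IH2]]; first by [].
  by have [h1 h2 _ _] := ssub n; split; [exact: le_trans h1|exact: le_trans h2].
have [||p [q [r pqr]]] := D s0 t0.
- by have := s0P 0%N; rewrite /= aw.
- by have := t0P 0%N; rewrite /= ch.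
pose K := (b - a) + (d - c).
have K0 : 0 < K by rewrite addr_gt0 ?subr_gt0.
(* Multiplied by 4^n, the bound 2 e (w n + h n)^2 of level n becomes 2 e K^2, which this e makes
   half of eta times the full area. *)
pose e := eta * ((b - a) * (d - c)) / (4 * K ^+ 2).
have e0 : 0 < e.
  apply: divr_gt0; first by rewrite !mulr_gt0 ?subr_gt0.
  by rewrite mulr_gt0 ?exprn_gt0.
have [de de0 Hde] := pqr e e0.
have [n nK] := exists_div_exp2_lt K de0.
have KE : K / 2 ^+ n = w n + h n by rewrite /K mulrDl.
have wn0 := w_gt0 n; have hn0 := h_gt0 n.
have /andP[s1 s2] := s0P n; have /andP[t1 t2] := t0P n.
have := @rect_int_le A (s n).1 ((s n).1 + w n) (s n).2 ((s n).2 + h n) u v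
  s0 t0 p q r (e * (w n + h n)) cu cv.
have [as1 as2] := as_ n.
move=> /(_ (lt_le_trans Aa as1) (lt_le_trans Ac as2)).
rewrite !lerDl (ltW wn0) (ltW hn0) => /(_ isT isT).
have xyx x y : x + y - x = y :> R by rewrite addrAC subrr add0r.
rewrite !xyx => JJ.
have {}JJ : eta * (w n * h n) <= 2 * (e * (w n + h n)) * (w n + h n).
  apply: (le_trans (sbad n)); apply: JJ => s' t' /andP[s3 s4] /andP[t3 t4].
  have ss : `|s' - s0| <= w n.
    by rewrite ler_norml; move: s1 s2 s3 s4; clear; lra.
  have tt : `|t' - t0| <= h n.
    by rewrite ler_norml; move: t1 t2 t3 t4; clear; lra.
  have [||h1 h2] := Hde s' t'.
  - by apply: le_lt_trans nK; rewrite KE; move: ss tt wn0 hn0; clear; lra.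
  - by apply: le_lt_trans nK; rewrite KE; move: ss tt wn0 hn0; clear; lra.
  by split; [apply: le_trans h1 _|apply: le_trans h2 _];
    rewrite ler_wpM2l ?(ltW e0)// lerD.
have : eta * ((b - a) * (d - c)) <= 2 * (e * K) * K.
  have E0 : (2 ^+ n : R) != 0 by rewrite lt0r_neq0// exprn_gt0.
  have := ler_wpM2r (ltW (mulr_gt0 (exprn_gt0 n (@ltr0Sn R 1))
     (exprn_gt0 n (@ltr0Sn R 1)))) JJ.
  rewrite -KE /w /h; congr (_ <= _); field; exact: E0.
rewrite /e.
have -> : 2 * (eta * ((b - a) * (d - c)) / (4 * K ^+ 2) * K) * K =
   eta * ((b - a) * (d - c)) / 2 by field; exact: lt0r_neq0.
have : 0 < eta * ((b - a) * (d - c)) by rewrite !mulr_gt0 ?subr_gt0.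
by clear; lra.
Qed.
End Goursat.

(** * Complex numbers in real coordinates *)

Section ComplexBasics.
Variable R : realType.
Local Notation C := (Cplx R).
Implicit Types (z w : C).

Definition cplx (a b : R) : C := Complex a b.
Definition RtoC (x : R) : C := cplx x 0.
Definition re z : R := complex.Re z.
Definition im z : R := complex.Im z.
Definition cconj z : C := conjc z.
(** The norm on [Cplx R] takes its values in [Cplx R]; a modulus with values in R is open to real
    arithmetic. *)
Definition cabs z : R := Num.sqrt (re z ^+ 2 + im z ^+ 2).

Lemma cplx_eta z : z = cplx (re z) (im z). Proof. by case: z. Qed.

Lemma cplx_eq z w : re z = re w -> im z = im w -> z = w.
Proof. by move=> h1 h2; rewrite (cplx_eta z) h1 h2 -cplx_eta. Qed.

Lemma normE z : `|z| = RtoC (cabs z). Proof. exact: normc_def. Qed.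

Lemma reD z w : re (z + w) = re z + re w. Proof. by case: z; case: w. Qed.
Lemma imD z w : im (z + w) = im z + im w. Proof. by case: z; case: w. Qed.
Lemma reN z : re (- z) = - re z. Proof. by case: z. Qed.
Lemma imN z : im (- z) = - im z. Proof. by case: z. Qed.
Lemma reB z w : re (z - w) = re z - re w. Proof. by rewrite reD reN. Qed.
Lemma imB z w : im (z - w) = im z - im w. Proof. by rewrite imD imN. Qed.
Lemma reM z w : re (z * w) = re z * re w - im z * im w.
Proof. by case: z; case: w. Qed.
Lemma imM z w : im (z * w) = re z * im w + im z * re w.
Proof. by case: z => a b; case: w => c d; rewrite /= addrC. Qed.
Lemma re_cconj z : re (cconj z) = re z. Proof. by case: z. Qed.
Lemma im_cconj z : im (cconj z) = - im z. Proof. by case: z. Qed.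
Lemma re1 : re 1 = 1. Proof. by []. Qed.
Lemma im1 : im 1 = 0. Proof. by []. Qed.

Lemma le_RtoC (a b : R) : (RtoC a <= RtoC b) = (a <= b). Proof. exact: lecR. Qed.
Lemma lt_RtoC (a b : R) : (RtoC a < RtoC b) = (a < b). Proof. exact: ltcR. Qed.
Lemma RtoCD (a b : R) : RtoC (a + b) = RtoC a + RtoC b.
Proof. by apply: cplx_eq; rewrite ?reD ?imD//= addr0. Qed.
Lemma RtoCM (a b : R) : RtoC (a * b) = RtoC a * RtoC b.
Proof. by apply: cplx_eq; rewrite ?reM ?imM//= !mul0r ?mulr0 ?subr0 ?addr0. Qed.
Lemma RtoC_inj : injective RtoC. Proof. by move=> a b []. Qed.

Lemma cabs_ge0 z : 0 <= cabs z. Proof. exact: sqrtr_ge0. Qed.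
Lemma cabs_sqr z : cabs z ^+ 2 = re z ^+ 2 + im z ^+ 2.
Proof. by rewrite sqr_sqrtr// addr_ge0// sqr_ge0. Qed.
Lemma cabs0 : cabs 0 = 0. Proof. by rewrite /cabs /= expr0n addr0 sqrtr0. Qed.
Lemma cabs1 : cabs 1 = 1.
Proof. by apply: RtoC_inj; rewrite -normE normr1. Qed.
Lemma cabs0_eq0 z : cabs z = 0 -> z = 0.
Proof. by move=> h; apply/eqP; rewrite -normr_eq0 normE h. Qed.
Lemma cabs_eq0 z : (cabs z == 0) = (z == 0).
Proof. by apply/eqP/eqP => [/cabs0_eq0//|->]; exact: cabs0. Qed.
Lemma cabs_gt0 z : (0 < cabs z) = (z != 0).
Proof. by rewrite lt_neqAle cabs_ge0 andbT eq_sym cabs_eq0. Qed.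
Lemma cabsD z w : cabs (z + w) <= cabs z + cabs w.
Proof. by rewrite -le_RtoC RtoCD -!normE ler_normD. Qed.
Lemma cabsN z : cabs (- z) = cabs z.
Proof. by apply: RtoC_inj; rewrite -!normE normrN. Qed.
Lemma cabsB z w : cabs (z - w) <= cabs z + cabs w.
Proof. by rewrite -(cabsN w) cabsD. Qed.
Lemma cabsC z w : cabs (z - w) = cabs (w - z).
Proof. by rewrite -cabsN opprB. Qed.
Lemma cabs_sub_ge z w : cabs z - cabs w <= cabs (z - w).
Proof. by rewrite lerBlDr -{1}(subrK w z) cabsD. Qed.
Lemma cabsM z w : cabs (z * w) = cabs z * cabs w.
Proof. by apply: RtoC_inj; rewrite RtoCM -!normE normrM. Qed.
Lemma cabsV z : cabs (z^-1) = (cabs z)^-1.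
Proof.
have [->|z0] := eqVneq z 0; first by rewrite invr0 cabs0 invr0.
apply: (mulfI (_ : cabs z != 0)); first by rewrite cabs_eq0.
by rewrite -cabsM !mulfV ?cabs1 ?cabs_eq0.
Qed.
Lemma cabs_cconj z : cabs (cconj z) = cabs z.
Proof. by rewrite /cabs re_cconj im_cconj sqrrN. Qed.
Lemma cabs_RtoC (x : R) : cabs (RtoC x) = `|x|.
Proof. by rewrite /cabs /= expr0n addr0 sqrtr_sqr. Qed.
Lemma re_le z : `|re z| <= cabs z.
Proof.
rewrite -(@ler_pXn2r _ 2)// ?nnegrE ?cabs_ge0//.
by rewrite cabs_sqr real_normK ?num_real// lerDl sqr_ge0.
Qed.
Lemma im_le z : `|im z| <= cabs z.
Proof.
rewrite -(@ler_pXn2r _ 2)// ?nnegrE ?cabs_ge0//.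
by rewrite cabs_sqr real_normK ?num_real// lerDr sqr_ge0.
Qed.
Lemma cabs_le z : cabs z <= `|re z| + `|im z|.
Proof.
rewrite -(@ler_pXn2r _ 2)// ?nnegrE ?cabs_ge0// ?addr_ge0//.
rewrite cabs_sqr sqrrD !real_normK ?num_real//.
by rewrite addrAC lerDl mulrn_wge0// mulr_ge0.
Qed.

Lemma discE z : disc z <-> cabs z < 1.
Proof. by rewrite /disc/= normE lt_RtoC. Qed.
Lemma closed_discE z : closed_disc z <-> cabs z <= 1.
Proof. by rewrite /closed_disc/= normE le_RtoC. Qed.
Lemma circleE z : circle z <-> cabs z = 1.
Proof.
by rewrite /circle/= normE; split => [|->//] /(@RtoC_inj _ 1).
Qed.

(** Positivity in the order of C forces the imaginary part to vanish, so radii of balls are real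
    numbers. *)
Lemma RtoC_posP (e : C) : 0 < e -> exists2 x : R, 0 < x & e = RtoC x.
Proof.
move=> e0; exists (re e); first by move: e0; rewrite ltcE/= => /andP[].
by apply: cplx_eq => //; move: e0; rewrite ltcE/= => /andP[/eqP].
Qed.

Lemma nbhs_cabsP z (A : set C) :
  nbhs z A <-> exists2 e : R, 0 < e & forall w, cabs (w - z) < e -> A w.
Proof.
split=> [/nbhs_ballP[e /= /RtoC_posP[x x0 ->] H]|[e e0 H]].
  by exists x => // w wz; apply: H; rewrite /ball/= normE lt_RtoC cabsC.
apply/nbhs_ballP; exists (RtoC e); first by rewrite /= -[0]/(RtoC 0) lt_RtoC.
by move=> w; rewrite /ball/= normE lt_RtoC cabsC => /H.
Qed.

Lemma nbhs_cabs2P (z : C * C) (A : set (C * C)) :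
  nbhs z A <-> exists2 e : R, 0 < e &
    forall w : C * C, cabs (w.1 - z.1) < e -> cabs (w.2 - z.2) < e -> A w.
Proof.
split=> [[[P Q] /= [/nbhs_cabsP[e e0 eP] /nbhs_cabsP[d d0 dQ]] PQA]|[e e0 H]].
  exists (Num.min e d); first by rewrite lt_min e0.
  move=> [w1 w2] /=; rewrite !lt_min => /andP[h1 _] /andP[_ h2].
  by apply: PQA; split; [exact: eP|exact: dQ].
exists ([set w | cabs (w - z.1) < e], [set w | cabs (w - z.2) < e]).
  by split; apply/nbhs_cabsP; exists e.
by move=> [w1 w2] [/= h1 h2]; exact: H.
Qed.

Lemma cvg_cabsP (T : Type) (F : set_system T) (FF : Filter F) (f : T -> C) (l : C) :
  f @ F --> l <-> forall e : R, 0 < e -> \forall x \near F, cabs (f x - l) < e.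
Proof.
split=> [fl e e0|H A /nbhs_cabsP[e e0 eA]].
  by apply: (fl [set w | cabs (w - l) < e]); apply/nbhs_cabsP; exists e.
by near=> x; apply: eA; near: x; exact: H.
Unshelve. all: by end_near. Qed.

Lemma cabs_dist z w : `|cabs z - cabs w| <= cabs (z - w).
Proof. by rewrite ler_norml lerNl opprB cabs_sub_ge cabsC cabs_sub_ge. Qed.

Lemma continuous_cabs : continuous cabs.
Proof.
move=> z A /nbhs_ballP[e /= e0 H]; apply/nbhs_cabsP; exists e => // w wz; apply: H.
by rewrite /ball/= (le_lt_trans (cabs_dist _ _))// cabsC.
Qed.

Lemma continuous_re : continuous re.
Proof.
move=> z A /nbhs_ballP[e /= e0 H]; apply/nbhs_cabsP; exists e => // w wz; apply: H.
by rewrite /ball/= -reB (le_lt_trans (re_le _))// cabsC.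
Qed.

Lemma continuous_im : continuous im.
Proof.
move=> z A /nbhs_ballP[e /= e0 H]; apply/nbhs_cabsP; exists e => // w wz; apply: H.
by rewrite /ball/= -imB (le_lt_trans (im_le _))// cabsC.
Qed.

Lemma continuous_dist (c : C) : continuous (fun z => cabs (z - c)).
Proof.
move=> z A /nbhs_ballP[e /= e0 H]; apply/nbhs_cabsP; exists e => // w wz; apply: H.
rewrite /ball/= (le_lt_trans (cabs_dist _ _))// cabsC.
by have -> : w - c - (z - c) = w - z by ring.
Qed.

Lemma continuous_cplx : continuous (fun p : R * R => cplx p.1 p.2).
Proof.
move=> p; apply/cvg_cabsP => e e0; near=> q.
apply: le_lt_trans (cabs_le _) _; rewrite reB imB/=.
rewrite [e]splitr; apply: ltrD; near: q.
  have : (fun q : R * R => q.1) @ p --> p.1 by exact: cvg_fst.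
  by move/cvgr_distC_lt; apply; rewrite divr_gt0.
have : (fun q : R * R => q.2) @ p --> p.2 by exact: cvg_snd.
by move/cvgr_distC_lt; apply; rewrite divr_gt0.
Unshelve. all: by end_near. Qed.

Lemma closed_ball_closed (c : C) (r : R) : closed [set z | cabs (z - c) <= r].
Proof.
have -> : [set z | cabs (z - c) <= r] =
  (fun z => cabs (z - c)) @^-1` [set x | x <= r] by [].
apply: (@preimage_closed _ _ (fun z => cabs (z - c))); last exact: closed_le.
by move=> z _; exact: continuous_dist.
Qed.

Lemma compact_square (r : R) :
  compact [set z : C | -r <= re z <= r /\ -r <= im z <= r].
Proof.
have -> : [set z : C | -r <= re z <= r /\ -r <= im z <= r] =
   (fun p : R * R => cplx p.1 p.2) @` (`[-r, r] `*` `[-r, r]).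
  apply/seteqP; split=> [z /= [h1 h2]|_ [[x y] /= [+ +] <-]].
    by exists (re z, im z); rewrite -?cplx_eta//= !in_itv/=.
  by rewrite !in_itv.
apply: continuous_compact; first exact/continuous_subspaceT/continuous_cplx.
by apply: compact_setX; exact: segment_compact.
Qed.

Lemma compact_ballC (c : C) (r : R) : compact [set z | cabs (z - c) <= r].
Proof.
apply: (@subclosed_compact _ _
  [set z : C | -(r + cabs c) <= re z <= r + cabs c /\
               -(r + cabs c) <= im z <= r + cabs c]).
- exact: closed_ball_closed.
- exact: compact_square.
move=> z /= zr.
have zrc : cabs z <= r + cabs c.
  by rewrite -lerBlDr; exact: le_trans (cabs_sub_ge _ _) zr.
by split; rewrite -ler_norml (le_trans _ zrc)// ?re_le ?im_le.
Qed.

Lemma compact_closed_disc : compact (@closed_disc R).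
Proof.
have -> : @closed_disc R = [set z | cabs (z - 0) <= 1].
  by apply/seteqP; split => z; rewrite /= subr0 => /closed_discE.
exact: compact_ballC.
Qed.

Lemma compact_closed_bidisc : compact (@closed_bidisc R).
Proof. by apply: compact_setX; exact: compact_closed_disc. Qed.

Lemma closed_closed_bidisc : closed (@closed_bidisc R).
Proof.
by apply: compact_closed; [exact: norm_hausdorff|exact: compact_closed_bidisc].
Qed.

Lemma compact_sphereC (c : C) (r : R) : compact [set z | cabs (z - c) = r].
Proof.
apply: (@subclosed_compact _ _ [set z | cabs (z - c) <= r]); last 2 first.
- exact: compact_ballC.
- by move=> z /= ->.
have -> : [set z | cabs (z - c) = r] = [set z | cabs (z - c) <= r] `&`
    (fun z => cabs (z - c)) @^-1` [set x | r <= x].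
  apply/seteqP; split=> z /= => [->//|[h1 h2]].
  by apply/le_anti; rewrite h1 h2.
apply: closedI; first exact: closed_ball_closed.
apply: preimage_closed; last exact: closed_ge.
by move=> z _; exact: continuous_dist.
Qed.

(** Division-free form of the complex derivative, meaningful at w = z and with all bounds in R. *)
Definition cderiv (f : C -> C) (z A : C) := forall e : R, 0 < e ->
  exists2 d : R, 0 < d & forall w, cabs (w - z) < d ->
    cabs (f w - f z - A * (w - z)) <= e * cabs (w - z).

Lemma derivable_cderiv f z : derivable f z 1 -> exists A, cderiv f z A.
Proof.
move=> /cvg_ex[A Af]; exists A => e e0.
have : nbhs (0 : C) [set h | h != 0 ->
    cabs (h^-1 *: ((f \o shift z) (h *: 1) - f z) - A) < e].
  by apply: (cvg_cabsP _ _ _).1 Af e e0.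
move=> /nbhs_cabsP[d d0 H].
exists d => // w wz.
have [->|wz0] := eqVneq w z; first by rewrite !subrr mulr0 subr0 cabs0 mulr0.
have := H (w - z); rewrite /= subr0 subr_eq0.
move=> /(_ wz wz0) /ltW; rewrite /GRing.scale/= mulr1 subrK => h.
have wz1 : 0 < cabs (w - z) by rewrite cabs_gt0 subr_eq0.
rewrite -ler_pdivrMr// -cabsV -cabsM; congr (_ <= _) : h; congr cabs.
by field; rewrite subr_eq0.
Qed.

Lemma cderiv_is_derive f z A : cderiv f z A -> is_derive z 1 f A.
Proof.
move=> fA.
have h : (fun h => h^-1 *: (f (h *: (1 : C) + z) - f z)) @ 0^' --> A.
  apply/cvg_cabsP => e e0; have [d d0 H] := fA (e / 2) (divr_gt0 e0 (ltr0Sn _ 1)).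
  have : nbhs (0 : C) [set h | h != 0 ->
    cabs (h^-1 *: (f (h *: (1 : C) + z) - f z) - A) < e]; last exact.
  apply/nbhs_cabsP; exists d => // h; rewrite subr0 => hd h0.
  rewrite /GRing.scale/= mulr1.
  have := H (h + z); rewrite addrK => /(_ hd) {}H.
  apply: (@le_lt_trans _ _ (e / 2)); last by rewrite ltr_pdivrMr// ltr_pMr// ltr1n.
  have h1 : 0 < cabs h by rewrite cabs_gt0.
  rewrite -(ler_pM2r h1) -cabsM; congr (_ <= _) : H; congr cabs.
  by field.
by apply: DeriveDef; [apply/cvg_ex; exists A|exact/cvg_lim].
Qed.

End ComplexBasics.

(** * The mean value inequality *)

Section MeanValue.
Variable R : realType.
Local Notation C := (Cplx R).
Implicit Types (z w : C).

Lemma is_derive_remainder (phi : R -> R) (x a : R) : is_derive x 1 phi a ->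
  forall e : R, 0 < e -> exists2 d : R, 0 < d & forall y, `|y - x| < d ->
    `|phi y - phi x - a * (y - x)| <= e * `|y - x|.
Proof.
move=> [dphi phia] e e0.
have : nbhs (0 : R) [set h | h != 0 ->
    `|a - h^-1 *: ((phi \o shift x) (h *: 1) - phi x)| < e].
  have L : h^-1 *: ((phi \o shift x) (h *: 1) - phi x) @[h --> 0^'] --> a.
    by rewrite -phia; exact: dphi.
  exact: ((cvgrPdist_lt _ _).1 L e e0).
move=> /nbhs_ballP[d /= d0 H].
exists d => // y yx.
have [->|yx0] := eqVneq y x; first by rewrite !subrr mulr0 subr0 normr0 mulr0.
have := H (y - x); rewrite /ball/= sub0r normrN subr_eq0.
move=> /(_ yx yx0) /ltW; rewrite /GRing.scale/= mulr1 subrK => h.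
have yx1 : 0 < `|y - x| by rewrite normr_gt0 subr_eq0.
have -> : phi y - phi x - a * (y - x) =
    - ((a - (y - x)^-1 * (phi y - phi x)) * (y - x)).
  by field; rewrite subr_eq0.
by rewrite normrN normrM ler_wpM2r.
Qed.

Definition cis (t : R) : C := cplx (cos t) (sin t).
Definition polar (p : C) (s t : R) : C := p + RtoC (expR s) * cis t.

Lemma cabs_polar p s t : cabs (polar p s t - p) = expR s.
Proof.
rewrite addrAC subrr add0r cabsM cabs_RtoC ger0_norm ?expR_ge0//.
by rewrite /cabs/= cos2Dsin2 sqrtr1 mulr1.
Qed.

Lemma polar_shift p s t s0 t0 : polar p s t - p =
  (polar p s0 t0 - p) * (RtoC (expR (s - s0)) * cis (t - t0)).
Proof.
rewrite /polar ![p + _ - p]addrAC subrr !add0r.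
have -> : forall a b c d : C, a * b * (c * d) = (c * a) * (d * b).
  by move=> a b c d; ring.
rewrite -RtoCM -expRD subrK; congr (_ * _).
have -> : cis t = cis ((t - t0) + t0) by rewrite subrK.
apply: cplx_eq; rewrite ?reM ?imM/=; first by rewrite cosD.
by rewrite sinD; ring.
Qed.

(** Differentiability of exp at 0 in real coordinates; [polar_shift] carries it to any base
    point. *)
Lemma exp_cis_remainder (e : R) : 0 < e -> exists2 d : R, 0 < d &
  forall x y : R, `|x| < d -> `|y| < d ->
  cabs (RtoC (expR x) * cis y - 1 - cplx x y) <= e * (`|x| + `|y|).
Proof.
move=> e0; pose e1 := Num.min 1 (e / 8).
have e10 : 0 < e1 by rewrite lt_min ltr01 divr_gt0.
have e11 : e1 <= 1 by rewrite ge_min lexx.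
have e1e : e1 <= e / 8 by rewrite ge_min lexx orbT.
have [d1 d10 H1] := is_derive_remainder (is_derive_expR (0 : R)) e10.
have [d2 d20 H2] := is_derive_remainder (is_derive_sin (0 : R)) e10.
have [d3 d30 H3] := is_derive_remainder (is_derive_cos (0 : R)) e10.
(* The radius e1 / 2 gives |exp x - 1| <= e1, which absorbs the cross term (exp x - 1) y of the
   imaginary part. *)
exists (Num.min (Num.min d1 d2) (Num.min d3 (e1 / 2))).
  by rewrite !lt_min d10 d20 d30 divr_gt0.
move=> x y; rewrite !lt_min => /andP[/andP[x1 _] /andP[_ xe]].
move=> /andP[/andP[_ y2] /andP[y3 _]].
have := H1 x; rewrite subr0 expR0 mul1r => /(_ x1) {}H1.
have := H2 y; rewrite subr0 cos0 mul1r sin0 subr0 => /(_ y2) {}H2.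
have := H3 y; rewrite subr0 sin0 oppr0 mul0r cos0 subr0 => /(_ y3) {}H3.
apply: le_trans (cabs_le _) _.
rewrite !(reB, imB, reM, imM) re1 im1 /= !mul0r ?subr0 ?addr0.
have X0 := expR_gt0 x.
set X := expR x in H1 X0 *; set c := cos y in H3 *; set s := sin y in H2 *.
have ex1 : `|X - 1| <= 2 * `|x|.
  have := ler_normD (X - 1 - x) x; rewrite subrK.
  have : e1 * `|x| <= 1 * `|x| by rewrite ler_wpM2r.
  by move: H1; clear; lra.
have X2 : X <= 2.
  by move: ex1 xe e11; rewrite ler_norml => /andP[_]; clear; lra.
have A1 : `|X * c - 1 - x| <= 2 * (e1 * `|y|) + e1 * `|x|.
  have -> : X * c - 1 - x = X * (c - 1) + (X - 1 - x) by ring.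
  apply: le_trans (ler_normD _ _) _; apply: lerD => //.
  rewrite normrM (gtr0_norm X0); apply: ler_pM => //; exact: ltW.
have A2 : `|X * s - y| <= 2 * (e1 * `|y|) + e1 * `|y|.
  have -> : X * s - y = X * (s - y) + (X - 1) * y by ring.
  apply: le_trans (ler_normD _ _) _; apply: lerD.
    rewrite normrM (gtr0_norm X0); apply: ler_pM => //; exact: ltW.
  rewrite normrM; apply: ler_wpM2r => //; apply: le_trans ex1 _.
  by move: xe; clear; lra.
apply: (le_trans (lerD A1 A2)).
have : e1 * `|x| <= e / 8 * `|x| by rewrite ler_wpM2r.
have : e1 * `|y| <= e / 8 * `|y| by rewrite ler_wpM2r.
have : 0 <= e * `|x| by rewrite mulr_ge0 // ltW.
have : 0 <= e * `|y| by rewrite mulr_ge0 // ltW.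
by clear; lra.
Qed.

(** Chain rule along z = p + exp (s + i t): the derivative at the base point z0 is G = A (z0 - p).
    Multiplication by G = a + i b has the real matrix with rows (a, -b) and (b, a), which is the
    shape asked for by [goursat_rect]. *)
Lemma cderiv_polar (f : C -> C) p s0 t0 A : cderiv f (polar p s0 t0) A ->
  exists a b : R, forall e : R, 0 < e -> exists2 d : R, 0 < d & forall s t,
    `|s - s0| < d -> `|t - t0| < d ->
    `|re (f (polar p s t)) - re (f (polar p s0 t0)) - a * (s - s0) - (- b) * (t - t0)|
       <= e * (`|s - s0| + `|t - t0|) /\
    `|im (f (polar p s t)) - im (f (polar p s0 t0)) - b * (s - s0) - a * (t - t0)|
       <= e * (`|s - s0| + `|t - t0|).
Proof.
move=> fA; pose Q := polar p s0 t0 - p; pose G := A * Q.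
exists (re G), (im G) => e e0.
suff [d d0 H] : exists2 d : R, 0 < d & forall s t,
    `|s - s0| < d -> `|t - t0| < d ->
    cabs (f (polar p s t) - f (polar p s0 t0) - G * cplx (s - s0) (t - t0))
      <= e * (`|s - s0| + `|t - t0|).
  exists d => // s t sd td; have := H s t sd td; split.
    apply: le_trans (H s t sd td); apply: le_trans (re_le _).
    by rewrite !(reB, reM)/=; rewrite le_eqVlt; apply/orP; left; apply/eqP; congr `|_|; ring.
  apply: le_trans (H s t sd td); apply: le_trans (im_le _).
  by rewrite !(imB, imM)/=; rewrite le_eqVlt; apply/orP; left; apply/eqP; congr `|_|; ring.
have q0 : 0 <= cabs Q := cabs_ge0 _.
have a0 : 0 <= cabs A := cabs_ge0 _.
pose e1 := e / (2 * (3 * cabs Q + 1)).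
have e10 : 0 < e1 by apply: divr_gt0 => //; move: q0; clear; lra.
have e1E : e1 * (3 * cabs Q) <= e / 2.
  have -> : e / 2 = e1 * (3 * cabs Q + 1).
    by rewrite /e1; field; apply/lt0r_neq0; move: q0; clear; lra.
  by rewrite ler_wpM2l ?(ltW e10)// lerDl.
pose e2 := Num.min 1 (e / (2 * (cabs A * cabs Q + 1))).
have aq0 : 0 <= cabs A * cabs Q by rewrite mulr_ge0.
have e20 : 0 < e2.
  by rewrite lt_min ltr01 /=; apply: divr_gt0 => //; move: aq0; clear; lra.
have e2E : e2 * (cabs A * cabs Q) <= e / 2.
  have -> : e / 2 = e / (2 * (cabs A * cabs Q + 1)) * (cabs A * cabs Q + 1).
    by field; apply/lt0r_neq0; move: aq0; clear; lra.
  by apply: ler_pM => //; [exact: ltW|rewrite ge_min lexx orbT|rewrite lerDl].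
have e21 : e2 <= 1 by rewrite ge_min lexx.
have [d1 d10 H1] := fA e1 e10.
have [d2 d20 H2] := exp_cis_remainder e20.
pose d3 := d1 / (6 * (cabs Q + 1)).
have d30 : 0 < d3 by apply: divr_gt0 => //; move: q0; clear; lra.
have d3E : cabs Q * (6 * d3) < d1.
  have -> : d1 = (cabs Q + 1) * (6 * d3).
    by rewrite /d3; field; apply/lt0r_neq0; move: q0; clear; lra.
  by rewrite ltr_pM2r ?ltrDl// mulr_gt0.
exists (Num.min d2 d3); first by rewrite lt_min d20.
move=> s t; rewrite !lt_min => /andP[s2 s3] /andP[t2 t3].
have {}H2 := H2 _ _ s2 t2.
set x := s - s0 in s2 s3 H2 *; set y := t - t0 in t2 t3 H2 *.
pose L : R := `|x| + `|y|; have L0 : 0 <= L by rewrite addr_ge0.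
set W := RtoC (expR x) * cis y in H2.
have PP : polar p s t - polar p s0 t0 = Q * (W - 1).
  rewrite mulrBr mulr1 -polar_shift /Q; ring.
have W3 : cabs (W - 1) <= 3 * L.
  have := cabsD (W - 1 - cplx x y) (cplx x y); rewrite subrK.
  have := cabs_le (cplx x y); rewrite /= -/L.
  have : e2 * L <= 1 * L by rewrite ler_wpM2r.
  by move: H2 L0; rewrite -/L; clear; lra.
have PL : cabs (polar p s t - polar p s0 t0) <= cabs Q * (3 * L).
  by rewrite PP cabsM ler_wpM2l.
have {}H1 := H1 (polar p s t) _.
have -> : f (polar p s t) - f (polar p s0 t0) - G * cplx x y =
  (f (polar p s t) - f (polar p s0 t0) - A * (polar p s t - polar p s0 t0)) +
  A * Q * (W - 1 - cplx x y) by rewrite PP /G; ring.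
apply: le_trans (cabsD _ _) _.
have -> : e * L = e / 2 * L + e / 2 * L by field.
apply: lerD.
  apply: le_trans (H1 _) _.
    apply: le_lt_trans PL _; apply: le_lt_trans d3E.
    apply: ler_wpM2l => //; move: s3 t3; rewrite /L; clear; lra.
  apply: le_trans (_ : e1 * (cabs Q * (3 * L)) <= _).
    by rewrite ler_wpM2l ?(ltW e10).
  have -> : e1 * (cabs Q * (3 * L)) = e1 * (3 * cabs Q) * L by ring.
  by rewrite ler_wpM2r.
rewrite !cabsM; apply: le_trans (_ : cabs A * cabs Q * (e2 * L) <= _).
  by rewrite ler_wpM2l.
by rewrite mulrA [_ * e2]mulrC ler_wpM2r.
Qed.


Lemma cderiv_continuous (f : C -> C) z A : cderiv f z A -> {for z, continuous f}.
Proof. by move/cderiv_is_derive => [/derivable1_diffP/differentiable_continuous]. Qed.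

Lemma continuous_cplx_pair (g h : R -> R) (x : R) :
  {for x, continuous g} -> {for x, continuous h} ->
  {for x, continuous (fun y => cplx (g y) (h y))}.
Proof.
move=> cg ch; apply/cvg_cabsP => e e0; near=> y.
apply: le_lt_trans (cabs_le _) _; rewrite reB imB/=.
rewrite [e]splitr; apply: ltrD; near: y.
  by move/cvgr_distC_lt : cg; apply; rewrite divr_gt0.
by move/cvgr_distC_lt : ch; apply; rewrite divr_gt0.
Unshelve. all: by end_near. Qed.

Lemma polarE p s t :
  polar p s t = cplx (re p + expR s * cos t) (im p + expR s * sin t).
Proof.
by apply: cplx_eq; rewrite /polar ?reD ?imD ?reM ?imM/= mul0r ?subr0 ?addr0.
Qed.

Lemma continuous_polar_l p t : continuous (fun s => polar p s t).
Proof.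
move=> s; have -> : polar p ^~ t =
  fun s => cplx (re p + expR s * cos t) (im p + expR s * sin t).
  by apply/funext => ?; exact: polarE.
apply: (@continuous_cplx_pair (fun s => re p + expR s * cos t)
  (fun s => im p + expR s * sin t)); apply: continuousD;
  do ?[exact: cvg_cst|apply: continuousM|exact: continuous_expR].
Qed.

Lemma continuous_polar_r p s : continuous (polar p s).
Proof.
move=> t; have -> : polar p s =
  fun t => cplx (re p + expR s * cos t) (im p + expR s * sin t).
  by apply/funext => ?; exact: polarE.
apply: (@continuous_cplx_pair (fun t => re p + expR s * cos t)
  (fun t => im p + expR s * sin t)); apply: continuousD;
  do ?[exact: cvg_cst|apply: continuousM|exact: continuous_cos
      |exact: continuous_sin].
Qed.

Lemma continuous_cpolar (f : C -> C) p s t : {for polar p s t, continuous f} ->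
  [/\ {for s, continuous (fun s => re (f (polar p s t)))},
      {for t, continuous (fun t => re (f (polar p s t)))},
      {for s, continuous (fun s => im (f (polar p s t)))} &
      {for t, continuous (fun t => im (f (polar p s t)))}].
Proof.
move=> cf.
have c1 : {for s, continuous (fun s => f (polar p s t))}.
  by apply: continuous_comp; [exact: continuous_polar_l|exact: cf].
have c2 : {for t, continuous (fun t => f (polar p s t))}.
  by apply: continuous_comp; [exact: continuous_polar_r|exact: cf].
split.
- apply: (@continuous_comp _ _ _ (fun s => f (polar p s t)) (@re R)).
    exact: c1.
  exact: continuous_re.
- apply: (@continuous_comp _ _ _ (fun t => f (polar p s t)) (@re R)).
    exact: c2.
  exact: continuous_re.
- apply: (@continuous_comp _ _ _ (fun s => f (polar p s t)) (@im R)).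
    exact: c1.
  exact: continuous_im.
- apply: (@continuous_comp _ _ _ (fun t => f (polar p s t)) (@im R)).
    exact: c2.
  exact: continuous_im.
Qed.

Lemma min_dist_le (s t S : R) : `|Num.min s S - Num.min t S| <= `|s - t|.
Proof.
have := ler_norm (s - t); have := ler_norm (t - s); rewrite distrC.
by rewrite ler_norml; case: (leP s S); case: (leP t S); lra.
Qed.

(* In the coordinates p + exp (s + i t), Goursat's lemma says that the mean of f
   over a circle about p does not depend on the radius, which tends to 0. The
   truncation at S makes the integrands continuous on the whole line. *)
Lemma mean_value_le (f : C -> C) (p : C) (r r0 M : R) : 0 < r -> r < r0 ->
  {for p, continuous f} ->
  (forall z, 0 < cabs (z - p) -> cabs (z - p) < r0 -> exists A, cderiv f z A) ->
  (forall z, cabs (z - p) = r -> re (f z) <= M) -> re (f p) <= M.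
Proof.
move=> r_gt0 rr0 cfp df fM; rewrite leNgt; apply/negP => Mfp.
pose r1 := (r + r0) / 2.
have rr1 : r < r1 by rewrite /r1; move: rr0; clear; lra.
have r10 : r1 < r0 by rewrite /r1; move: rr0; clear; lra.
have r1_gt0 : 0 < r1 by exact: lt_trans rr1.
pose S := ln r1.
pose u s t := re (f (polar p (Num.min s S) t)).
pose v s t := im (f (polar p (Num.min s S) t)).
have dfp s t : exists A, cderiv f (polar p (Num.min s S) t) A.
  apply: df; rewrite cabs_polar ?expR_gt0//; apply: le_lt_trans r10.
  by rewrite -[leRHS]lnK ?posrE// ler_expR ge_min lexx orbT.
have cfc s t : {for polar p (Num.min s S) t, continuous f}.
  by have [A] := dfp s t; exact: cderiv_continuous.
have cmin : continuous (fun s : R => Num.min s S).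
  move=> s B /nbhs_ballP[e /= e0 H]; apply/nbhs_ballP; exists e => // y.
  rewrite /ball/= => sy; apply: H; rewrite /ball/=.
  by apply: le_lt_trans sy; exact: min_dist_le.
have cu s : continuous (u s).
  by move=> t; have [_ + _ _] := continuous_cpolar (cfc s t).
have cv t : continuous (v^~ t).
  move=> s; have [_ _ + _] := continuous_cpolar (cfc s t).
  by apply: (@continuous_comp _ _ _ (fun s => Num.min s S)
    (fun s => im (f (polar p s t)))); exact: cmin.
pose eta := (re (f p) - M) / 2.
have eta0 : 0 < eta by rewrite divr_gt0 ?subr_gt0.
have /nbhs_cabsP[d d0 Hd] : nbhs p [set z | cabs (f z - f p) < eta].
  exact: ((cvg_cabsP _ _ _).1 cfp eta eta0).
(* The inner circle must lie where f is within eta of f p, and inside the outer circle. *)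
pose a := ln (Num.min (d / 2) (r / 2)).
have m0 : 0 < Num.min (d / 2) (r / 2) by rewrite lt_min !divr_gt0.
pose b := ln r.
have ea : expR a = Num.min (d / 2) (r / 2) by rewrite lnK ?posrE.
have eb : expR b = r by rewrite lnK ?posrE.
have ab : a < b.
  rewrite -ltr_expR ea eb gt_min; apply/orP; right.
  by rewrite ltr_pdivrMr// ltr_pMr// ltr1n.
have bS : b < S by rewrite -ltr_expR eb lnK ?posrE.
(* The primitives start to the left of both parameter ranges, [a, b] for s and [0, 2 pi] for t. *)
pose A := Num.min a 0 - 1.
have Aa : A < a.
  rewrite /A; have : Num.min a 0 <= a by rewrite ge_min lexx.
  by clear; lra.
have A0 : A < 0.
  rewrite /A; have : Num.min a 0 <= 0 by rewrite ge_min lexx orbT.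
  by clear; lra.
have pi20 : 0 < 2 * pi :> R by rewrite mulr_gt0// pi_gt0.
have := @goursat_rect R A a b 0 (2 * pi) u v cu cv Aa A0 ab pi20.
(* The sides t = 0 and t = 2 pi cancel by periodicity; what remains compares the means over the two
   circles. *)
have -> : rect_int A u v a b 0 (2 * pi) =
    (prim A (u b) (2 * pi) - prim A (u b) 0) -
    (prim A (u a) (2 * pi) - prim A (u a) 0).
  rewrite /rect_int.
  have -> : v^~ (2 * pi) = v^~ 0.
    apply/funext => s; rewrite /v; congr (im (f (_ + _ * _))).
    by rewrite /cis -[2 * pi]add0r mulr_natl cosD2pi sinD2pi.
  by rewrite [X in X - _ = _]addrAC subrr add0r.
have D (s : R) x : 0 <= x <= 2 * pi ->
  is_derive x 1 (prim A (u s)) (u s x).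
  by move=> /andP[x0 _]; apply: is_derive_prim => //; exact: lt_le_trans x0.
have D0 (k : R) (x : R) : 0 <= x <= 2 * pi ->
  is_derive x 1 (fun y : R => k * y) k.
  by move=> _; apply: is_derive_eq; rewrite /GRing.scale/= mulr1.
have ub : prim A (u b) (2 * pi) - prim A (u b) 0 <= M * (2 * pi).
  have := @derive_sub_le R (prim A (u b)) (fun y => M * y) (u b) (fun=> M)
    0 (2 * pi) 0 (ltW pi20) (D b) (D0 M).
  rewrite mulr0 mul0r !subr0 subr_le0; apply => x _.
  rewrite subr_le0; apply: fM; rewrite cabs_polar -[RHS]eb; congr expR.
  by apply/min_idPl; exact: ltW.
have ua : (M + eta) * (2 * pi) <= prim A (u a) (2 * pi) - prim A (u a) 0.
  have := @derive_sub_le R (fun y => (M + eta) * y) (prim A (u a)) (fun=> M + eta) (u a)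
    0 (2 * pi) 0 (ltW pi20) (D0 (M + eta)) (D a).
  rewrite mulr0 mul0r !subr0 subr_le0; apply => x _.
  rewrite subr_le0 /u.
  have -> : Num.min a S = a by apply/min_idPl/ltW/(lt_trans ab).
  have : cabs (f (polar p a x) - f p) < eta.
    apply: Hd; rewrite cabs_polar ea gt_min; apply/orP; left.
    by rewrite ltr_pdivrMr// ltr_pMr// ltr1n.
  move=> /(le_lt_trans (re_le _)); rewrite reB ltr_norml => /andP[+ _].
  by rewrite /eta; clear; lra.
move=> /(_ _)/eqP; rewrite subr_eq0 => G.
have /eqP E : prim A (u b) (2 * pi) - prim A (u b) 0 ==
    prim A (u a) (2 * pi) - prim A (u a) 0.
  apply: G => s0 t0 /andP[s0a s0b] _.
  have [B fB] := dfp s0 t0.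
  have s0S : s0 < S := le_lt_trans s0b bS.
  have s0E : Num.min s0 S = s0 by apply/min_idPl/ltW.
  rewrite s0E in fB.
  have [al [be H]] := cderiv_polar fB.
  exists al, (- be), be => e e0; have [de de0 {}H] := H e e0.
  exists (Num.min de (S - s0)); first by rewrite lt_min de0 subr_gt0.
  move=> s t; rewrite !lt_min => /andP[s1 s2] /andP[t1 _].
  have sE : Num.min s S = s.
    apply/min_idPl; move: s2; rewrite ltr_norml => /andP[_]; clear; lra.
  by rewrite /u /v sE s0E; exact: H.
rewrite -E in ua; have := le_trans ua ub.
by rewrite mulrDl gerDl leNgt mulr_gt0.
Qed.

End MeanValue.

(** * Maximum principle and openness *)

Section Holo.
Variable R : realType.
Local Notation C := (Cplx R).
Implicit Types (z w : C) (f g : C -> C).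

Lemma derivable_cderivP f z : derivable f z 1 <-> exists A, cderiv f z A.
Proof.
split; first exact: derivable_cderiv.
by case=> A /cderiv_is_derive[].
Qed.

Lemma cderiv_near_eq f g z A (d : R) : 0 < d ->
  (forall w, cabs (w - z) < d -> f w = g w) -> cderiv f z A -> cderiv g z A.
Proof.
move=> d0 fg fA e e0; have [d' d'0 H] := fA e e0.
exists (Num.min d d'); first by rewrite lt_min d0.
move=> w; rewrite lt_min => /andP[wd wd'].
by rewrite -!fg ?subrr ?cabs0//; exact: H.
Qed.

Lemma cderiv_lin f z A (a b c : C) : cderiv f z A ->
  cderiv (fun w => a * f w + b * w + c) z (a * A + b).
Proof.
move=> fA e e0; have a0 := cabs_ge0 a.
have [|d d0 H] := fA (e / (cabs a + 1)).
  by apply: divr_gt0 => //; move: a0; clear; lra.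
exists d => // w wd.
have -> : a * f w + b * w + c - (a * f z + b * z + c) - (a * A + b) * (w - z) =
  a * (f w - f z - A * (w - z)) by ring.
rewrite cabsM; apply: le_trans (ler_wpM2l a0 (H w wd)) _.
rewrite mulrA ler_wpM2r ?cabs_ge0// mulrCA ler_piMr ?(ltW e0)//.
by rewrite ler_pdivrMr; move: a0; clear; lra.
Qed.

Lemma continuous_cabsP f z : {for z, continuous f} <->
  forall e : R, 0 < e -> exists2 d : R, 0 < d &
    forall w, cabs (w - z) < d -> cabs (f w - f z) < e.
Proof.
split=> [cf e e0|H A /nbhs_cabsP[e e0 eA]].
  have : nbhs (f z) [set w | cabs (w - f z) < e] by apply/nbhs_cabsP; exists e.
  by move=> /cf /nbhs_cabsP.
have [d d0 dH] := H e e0; apply/nbhs_cabsP; exists d => // w /dH; exact: eA.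
Qed.

Lemma continuous_lin f z (a b c : C) : {for z, continuous f} ->
  {for z, continuous (fun w => a * f w + b * w + c)}.
Proof.
move=> /continuous_cabsP cf; apply/continuous_cabsP => e e0.
have a1 : 0 < cabs a + 1 by rewrite ltr_wpDl ?cabs_ge0.
have b1 : 0 < cabs b + 1 by rewrite ltr_wpDl ?cabs_ge0.
have e2 : 0 < e / 2 by rewrite divr_gt0.
have [d d0 H] := cf _ (divr_gt0 e2 a1).
exists (Num.min d (e / 2 / (cabs b + 1))); first by rewrite lt_min d0 divr_gt0.
move=> w; rewrite lt_min => /andP[/H h1 h2].
have -> : a * f w + b * w + c - (a * f z + b * z + c) =
  a * (f w - f z) + b * (w - z) by ring.
apply: le_lt_trans (cabsD _ _) _; rewrite !cabsM [e]splitr.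
apply: ltrD.
  move: h1; rewrite ltr_pdivlMr//; apply: le_lt_trans.
  by rewrite mulrC ler_wpM2l ?cabs_ge0// lerDl.
move: h2; rewrite ltr_pdivlMr//; apply: le_lt_trans.
by rewrite mulrC ler_wpM2l ?cabs_ge0// lerDl.
Qed.

Lemma derivable_inv f z : f z != 0 -> derivable f z 1 ->
  derivable (fun w => (f w)^-1) z 1.
Proof. by move=> f0 df; exact: derivableV. Qed.

(** Multiplying by conj (g p) makes the value at p the real number |g p|^2, so that the mean value
    inequality for real parts applies. *)
Lemma max_center g (p : C) (r r0 M : R) : 0 < r -> r < r0 ->
  (forall z, cabs (z - p) < r0 -> derivable g z 1) ->
  (forall z, cabs (z - p) = r -> cabs (g z) <= M) -> cabs (g p) <= M.
Proof.
move=> r_gt0 rr0 dg gM.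
have [->|gp0] := eqVneq (g p) 0.
  rewrite cabs0; apply: le_trans (gM (p + RtoC r) _); first exact: cabs_ge0.
  by rewrite addrAC subrr add0r cabs_RtoC gtr0_norm.
have gp1 : 0 < cabs (g p) by rewrite cabs_gt0.
(* The zero terms match the shape of [cderiv_lin]. *)
pose f z := cconj (g p) * g z + 0 * z + 0.
have df z : cabs (z - p) < r0 -> exists A, cderiv f z A.
  by move=> /dg/derivable_cderiv[A gA]; exists (cconj (g p) * A + 0); exact: cderiv_lin.
have pp : cabs (p - p) < r0 by rewrite subrr cabs0 (lt_trans r_gt0).
have : re (f p) <= cabs (g p) * M.
  apply: (@mean_value_le _ f p r r0) => //.
  - by have [A] := df _ pp; exact: cderiv_continuous.
  - by move=> z _; exact: df.
  move=> z zr; apply: le_trans (ler_norm _) _; apply: le_trans (re_le _) _.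
  by rewrite /f mul0r !addr0 cabsM cabs_cconj ler_wpM2l ?gM// ltW.
have -> : re (f p) = cabs (g p) * cabs (g p).
  by rewrite /f mul0r !addr0 reM re_cconj im_cconj -[RHS]expr2 cabs_sqr; ring.
by rewrite ler_pM2l.
Qed.

(* The minimum modulus principle at an isolated point of the fibre. *)
Lemma isolated_open f (p : C) (r0 : R) : 0 < r0 ->
  (forall z, cabs (z - p) < r0 -> derivable f z 1) ->
  (forall z, 0 < cabs (z - p) -> cabs (z - p) < r0 -> f z != f p) ->
  exists2 d : R, 0 < d & forall w, cabs (w - f p) < d ->
    exists2 z, cabs (z - p) < r0 & f z = w.
Proof.
move=> r00 df fp; pose r := r0 / 2.
have r_gt0 : 0 < r by rewrite divr_gt0.
have rr0 : r < r0 by rewrite ltr_pdivrMr// ltr_pMr// ltr1n.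
have [] := @compact_EVT_min C R (fun z => cabs (f z - f p))
  [set z | cabs (z - p) = r].
- exists (p + RtoC r) => /=.
  by rewrite addrAC subrr add0r cabs_RtoC gtr0_norm.
- exact: compact_sphereC.
- apply/subspace_continuousP => z /= zr; apply: cvg_within_filter.
  apply: (@continuous_comp _ _ _ f (fun w => cabs (w - f p))).
    have [|A] := @derivable_cderiv _ f z; last exact: cderiv_continuous.
    by apply: df; rewrite zr.
  exact: continuous_dist.
move=> c; rewrite inE/= => cr cmin.
pose m := cabs (f c - f p).
have m0 : 0 < m by rewrite cabs_gt0 subr_eq0; apply: fp; rewrite cr.
(* On the circle |f - w| >= m / 2, whereas |f p - w| < m / 2: if w were not attained, 1 / (f - w)
   would violate the maximum principle. *)
exists (m / 2); first by rewrite divr_gt0.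
move=> w wm; apply: contrapT => nz.
have {}nz z : cabs (z - p) < r0 -> f z - w != 0.
  by rewrite subr_eq0 => zr; apply/eqP => fzw; apply: nz; exists z.
have := @max_center (fun z => (f z - w)^-1) p r r0 (m / 2)^-1 r_gt0 rr0.
have h1 z : cabs (z - p) < r0 -> derivable (fun z => (f z - w)^-1) z 1.
  move=> zr; apply: derivable_inv; first exact: nz.
  by apply: derivableB; [exact: df|exact: derivable_cst].
move=> /(_ h1) h2.
suff : cabs (f p - w)^-1 <= (m / 2)^-1.
  rewrite cabsV lef_pV2 ?posrE ?divr_gt0//.
    by rewrite leNgt cabsC wm.
  by rewrite cabs_gt0 nz// subrr cabs0.
apply: h2 => z zr; rewrite cabsV lef_pV2 ?posrE ?divr_gt0//; last first.
  by rewrite cabs_gt0 nz// zr.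
have := cmin z; rewrite inE/= => /(_ zr).
have := cabsD (f z - w) (w - f p).
have -> : f z - w + (w - f p) = f z - f p by ring.
by move: wm; rewrite -/m; clear; lra.
Qed.

(* The circle mean of |q|^2 + e |z|^2 would exceed its value at an interior
   maximum p, since |q z|^2 >= 2 Re (conj (q p) * q z) - |q p|^2. *)
Lemma max_punctured (q : C -> C) (rho rho1 M : R) : 0 < rho -> rho < rho1 ->
  {for 0, continuous q} ->
  (forall z, 0 < cabs z -> cabs z < rho1 -> derivable q z 1) ->
  (forall z, cabs z = rho -> cabs (q z) <= M) ->
  forall z, cabs z <= rho -> cabs (q z) <= M.
Proof.
move=> rho0 rho01 cq0 dq qM z0 z0r.
have cq z : cabs z < rho1 -> {for z, continuous q}.
  have [->//|z_neq0] := eqVneq z 0.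
  move=> /dq; rewrite cabs_gt0 => /(_ z_neq0)/derivable_cderiv[A].
  exact: cderiv_continuous.
have M0 : 0 <= M.
  apply: le_trans (qM (RtoC rho) _); first exact: cabs_ge0.
  by rewrite cabs_RtoC gtr0_norm.
suff H (e : R) : 0 < e -> cabs (q z0) ^+ 2 <= M ^+ 2 + e * rho ^+ 2.
  rewrite -(@ler_pXn2r _ 2)// ?nnegrE ?cabs_ge0//.
  apply/ler_addgt0Pr => e e0.
  have -> : e = e / rho ^+ 2 * rho ^+ 2 by rewrite divfK// expf_neq0// lt0r_neq0.
  by apply: H; rewrite divr_gt0// exprn_gt0.
move=> e0; pose Psi z := cabs (q z) ^+ 2 + e * cabs z ^+ 2.
have Pz0 : Psi z0 >= cabs (q z0) ^+ 2 by rewrite lerDl mulr_ge0 ?(ltW e0)// sqr_ge0.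
have [] := @compact_EVT_max C R Psi [set z | cabs (z - 0) <= rho].
- by exists 0; rewrite /= subrr cabs0 ltW.
- exact: compact_ballC.
- apply/subspace_continuousP => z /=; rewrite subr0 => zr.
  suff cPsi : {for z, continuous Psi} by apply: cvg_within_filter; exact: cPsi.
  apply: (@continuousD _ _ _ (fun z => cabs (q z) ^+ 2)
    (fun z => e * cabs z ^+ 2)).
    apply: (@continuous_comp _ _ _ (fun z => cabs (q z)) (fun x : R => x ^+ 2));
      last exact: exprn_continuous.
    apply: (@continuous_comp _ _ _ q); last exact: continuous_cabs.
    by apply: cq; exact: le_lt_trans zr _.
  apply: (@continuous_comp _ _ _ (@cabs R) (fun x : R => e * x ^+ 2)).
    exact: continuous_cabs.
  apply: (@continuousM _ _ (fun=> e) (fun x : R => x ^+ 2)).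
    exact: cvg_cst.
  exact: exprn_continuous.
move=> p; rewrite inE/= subr0 => pr pmax.
have z0p : Psi z0 <= Psi p by apply: pmax; rewrite inE/= subr0.
have [pr'|pr'] := eqVneq (cabs p) rho.
  apply: (le_trans Pz0); apply: (le_trans z0p); rewrite /Psi pr' lerD2r.
  by rewrite ler_pXn2r// ?nnegrE ?cabs_ge0// qM.
have {pr}pr' : cabs p < rho by rewrite lt_neqAle pr' pr.
(* The disc of radius r0 about p stays inside the disc of radius rho and avoids the puncture 0,
   unless p itself is the puncture. *)
pose r0 := if p == 0 then rho else Num.min (rho - cabs p) (cabs p).
have r00 : 0 < r0.
  rewrite /r0; case: eqVneq => [//|p0].
  by rewrite lt_min subr_gt0 pr' cabs_gt0.
have r0r : r0 <= rho - cabs p.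
  rewrite /r0; case: eqVneq => [->|p0]; first by rewrite cabs0 subr0.
  by rewrite ge_min lexx.
have r0p z : 0 < cabs (z - p) -> cabs (z - p) < r0 -> z != 0.
  rewrite /r0; case: (eqVneq p 0) => [->|p0]; first by rewrite subr0 cabs_gt0.
  move=> _; rewrite lt_min => /andP[_]; apply: contraTneq => ->.
  by rewrite sub0r cabsN ltxx.
pose r := r0 / 2.
have r_gt0 : 0 < r by rewrite divr_gt0.
have rr0 : r < r0 by rewrite ltr_pdivrMr// ltr_pMr// ltr1n.
(* On |z - p| = r one has Re (f z) <= Psi z - Psi p + 2 |q p|^2 - e r^2, while Re (f p) = 2 |q p|^2.
   As Psi is maximal at p, this contradicts the mean value inequality. *)
pose f z := (2 * cconj (q p)) * q z + (RtoC (2 * e) * cconj p) * z +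
  (- (RtoC (2 * e) * cconj p * p)).
have zin z : cabs (z - p) < r0 -> cabs z < rho1.
  move=> zp; have := cabsD (z - p) p; rewrite subrK.
  by move: zp r0r rho01; clear; lra.
have := @mean_value_le _ f p r r0 (2 * cabs (q p) ^+ 2 - e * r ^+ 2) r_gt0 rr0.
have cf : {for p, continuous f}.
  have cqp : {for p, continuous q} by apply: cq; exact: lt_trans rho01.
  exact: continuous_lin.
have df z : 0 < cabs (z - p) -> cabs (z - p) < r0 -> exists A, cderiv f z A.
  move=> zp zr; have /derivable_cderiv[A qA] : derivable q z 1.
    by apply: dq; [rewrite cabs_gt0; exact: r0p zr|exact: zin].
  by eexists; apply: cderiv_lin; exact: qA.
have E2 (x : C) : re (2 * x) = 2 * re x.
  by rewrite mulr_natl mulr2n reD; ring.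
have E3 (x : C) : im (2 * x) = 2 * im x.
  by rewrite mulr_natl mulr2n imD; ring.
have fE z : re (f z) = 2 * (re (q p) * re (q z) + im (q p) * im (q z)) +
   2 * e * (re p * (re z - re p) + im p * (im z - im p)).
  rewrite /f !(reD, reN) ![re (_ * _ * _)]reM E2 E3 !(reM, imM) !re_cconj.
  by rewrite !im_cconj /=; ring.
move=> /(_ cf df); rewrite fE !subrr !mulr0 !addr0 -!expr2 -cabs_sqr.
suff h : forall z, cabs (z - p) = r ->
    re (f z) <= 2 * cabs (q p) ^+ 2 - e * r ^+ 2.
  move=> /(_ h); have : 0 < e * r ^+ 2 by rewrite mulr_gt0// exprn_gt0.
  by clear; lra.
move=> z zr.
have zin2 : z \in [set z | cabs (z - 0) <= rho].
  rewrite inE/= subr0; have := cabsD (z - p) p; rewrite subrK zr.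
  by move: rr0 r0r; clear; lra.
have := pmax z zin2; rewrite /Psi !cabs_sqr fE -zr !cabs_sqr !(reB, imB).
have := sqr_ge0 (re (q z) - re (q p)); have := sqr_ge0 (im (q z) - im (q p)).
move: e0; set a1 := re (q z); set a2 := im (q z); set b1 := re (q p).
set b2 := im (q p); set x1 := re z; set x2 := im z; set y1 := re p; set y2 := im p.
by clear; nra.
Qed.

End Holo.

(** * The Schwarz-Pick lemma *)

Section SchwarzPick.
Variable R : realType.
Local Notation C := (Cplx R).
Implicit Types (z w p q : C) (f g h : C -> C).

(** The quotient h w / w, extended at 0 by the derivative, is only shown to be continuous there,
    hence the recourse to [max_punctured]. *)
Lemma schwarz h : (forall z, cabs z < 1 -> derivable h z 1) ->
  (forall z, cabs z < 1 -> cabs (h z) <= 1) -> h 0 = 0 ->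
  forall z, cabs z < 1 -> cabs (h z) <= cabs z.
Proof.
move=> dh h1 h0 z z1; rewrite leNgt; apply/negP => zh.
have [A hA] : exists A, cderiv h 0 A.
  by apply/derivable_cderiv/dh; rewrite cabs0.
pose q w := if w == 0 then A else h w / w.
have z0 : 0 < cabs z.
  by rewrite cabs_gt0; apply: contraTneq zh => ->; rewrite h0 cabs0 ltxx.
have hz0 : 0 < cabs (h z) := lt_trans z0 zh.
have t1 : cabs z / cabs (h z) < 1 by rewrite ltr_pdivrMr ?mul1r.
have zt : cabs z <= cabs z / cabs (h z).
  by rewrite ler_pdivlMr// ler_piMr ?h1// cabs_ge0.
(* Any radius strictly between |z| / |h z| and 1 will do: on that circle |q| <= 1 / rho < |h z| /
   |z|, which contradicts the value of q at z without a passage to the limit. *)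
pose rho := (cabs z / cabs (h z) + 1) / 2.
have rho1 : rho < 1 by rewrite /rho; move: t1; clear; lra.
have trho : cabs z / cabs (h z) < rho by rewrite /rho; move: t1; clear; lra.
have rho0 : 0 < rho by apply: le_lt_trans trho; rewrite divr_ge0 ?cabs_ge0.
have cq : {for 0, continuous q}.
  apply/continuous_cabsP => e e0.
  have [d d0 H] := hA (e / 2) (divr_gt0 e0 (ltr0Sn _ 1)).
  exists d => // w wd; rewrite /q eqxx; case: eqVneq => [_|w0].
    by rewrite subrr cabs0.
  have := H w wd; rewrite h0 !subr0 => {}H.
  have -> : h w / w - A = (h w - A * w) / w by field.
  have w1 : 0 < cabs w by rewrite cabs_gt0.
  rewrite cabsM cabsV ltr_pdivrMr//; apply: le_lt_trans H _.
  by rewrite ltr_pM2r// ltr_pdivrMr// ltr_pMr// ltr1n.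
have dq w : 0 < cabs w -> cabs w < 1 -> derivable q w 1.
  move=> w0 w1; apply/derivable_cderivP.
  have [B hB] : exists B, cderiv (fun w => h w * w^-1) w B.
    apply/derivable_cderiv; apply: derivableM; first exact: dh.
    by apply: derivable_inv; [rewrite -cabs_gt0|exact: derivable_id].
  exists B; apply: cderiv_near_eq hB; first exact: w0.
  move=> v vw; rewrite /q; case: eqVneq => // v0.
  by move: vw; rewrite v0 sub0r cabsN ltxx.
have := @max_punctured _ q rho 1 rho^-1 rho0 rho1 cq dq.
have qr w : cabs w = rho -> cabs (q w) <= rho^-1.
  move=> wr; rewrite /q; case: eqVneq => [w0|w0].
    by move: wr rho0; rewrite w0 cabs0 => ->; rewrite ltxx.
  rewrite cabsM cabsV wr ler_piMl ?invr_ge0 ?(ltW rho0)// h1// wr//.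
move=> /(_ qr z (ltW (le_lt_trans zt trho))).
rewrite /q; case: eqVneq => [zz|zz]; first by move: z0; rewrite zz cabs0 ltxx.
rewrite cabsM cabsV -[rho^-1]div1r ler_pdivlMr// mulrAC ler_pdivrMr// mul1r.
by move: trho; rewrite ltr_pdivrMr// mulrC => h2; rewrite leNgt h2.
Qed.

Lemma mobius_norm p w : cabs (1 - cconj p * w) ^+ 2 - cabs (w - p) ^+ 2 =
  (1 - cabs p ^+ 2) * (1 - cabs w ^+ 2).
Proof.
by rewrite !cabs_sqr !(reB, imB, reM, imM) re_cconj im_cconj re1 im1; ring.
Qed.

Lemma mobius_den p w : cabs p < 1 -> cabs w <= 1 -> 1 - cconj p * w != 0.
Proof.
move=> p1 w1; rewrite subr_eq0; apply/eqP => /(congr1 (@cabs R)).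
rewrite cabs1 cabsM cabs_cconj => E.
have : cabs p * cabs w < 1; last by rewrite -E ltxx.
by apply: le_lt_trans p1; rewrite ler_piMr ?cabs_ge0.
Qed.

Lemma mobius_le p w : cabs p < 1 -> cabs w <= 1 ->
  cabs (w - p) <= cabs (1 - cconj p * w).
Proof.
move=> p1 w1; rewrite -(@ler_pXn2r _ 2)// ?nnegrE ?cabs_ge0//.
rewrite -subr_ge0 mobius_norm mulr_ge0// subr_ge0 expr_le1 ?cabs_ge0//.
exact: ltW.
Qed.

Lemma mobius_lt p w : cabs p < 1 -> cabs w < 1 ->
  cabs (w - p) < cabs (1 - cconj p * w).
Proof.
move=> p1 w1; rewrite -(@ltr_pXn2r _ 2)// ?nnegrE ?cabs_ge0//.
by rewrite -subr_gt0 mobius_norm mulr_gt0// subr_gt0 expr_lt1 ?cabs_ge0.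
Qed.

(* Pseudo-hyperbolic distance at most k, with the denominator cleared. *)
Definition phdist_le (k : R) p q := cabs (p - q) <= k * cabs (1 - cconj p * q).

Lemma schwarz_pick g : (forall z, cabs z < 1 -> derivable g z 1) ->
  (forall z, cabs z < 1 -> cabs (g z) < 1) ->
  forall z, cabs z < 1 -> phdist_le (cabs z) (g 0) (g z).
Proof.
move=> dg g1 z z1.
have g01 : cabs (g 0) < 1 by apply: g1; rewrite cabs0.
pose h w := (g w - g 0) / (1 - cconj (g 0) * g w).
have den w : cabs w < 1 -> 1 - cconj (g 0) * g w != 0.
  by move=> w1; apply: mobius_den => //; exact/ltW/g1.
have := @schwarz h.
have dh w : cabs w < 1 -> derivable h w 1.
  move=> w1; apply: derivableM.
    by apply: derivableB; [exact: dg|exact: derivable_cst].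
  apply: derivable_inv; first exact: den.
  apply: derivableB; first exact: derivable_cst.
  by apply: derivableM; [exact: derivable_cst|exact: dg].
have h1 w : cabs w < 1 -> cabs (h w) <= 1.
  move=> w1; rewrite cabsM cabsV ler_pdivrMr ?mul1r ?cabs_gt0 ?den//.
  by apply: mobius_le => //; exact/ltW/g1.
move=> /(_ dh h1); rewrite /h subrr mul0r => /(_ erefl z z1).
by rewrite cabsM cabsV ler_pdivrMr ?cabs_gt0 ?den// /phdist_le cabsC.
Qed.

(** The pseudo-hyperbolic distance between r and -r, that is tanh (2 artanh r). *)
Definition pick_const (r : R) := 2 * r / (1 + r ^+ 2).

Lemma pick_const_gt0 r : 0 < r -> 0 < pick_const r.
Proof. by move=> r0; rewrite divr_gt0 ?mulr_gt0// addr_gt0// exprn_gt0. Qed.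

Lemma pick_const_lt1 r : 0 < r -> r < 1 -> pick_const r < 1.
Proof.
move=> r0 r1; have r20 : 0 < 1 + r ^+ 2 by rewrite addr_gt0// exprn_gt0.
rewrite ltr_pdivrMr// mul1r -subr_gt0.
have -> : 1 + r ^+ 2 - 2 * r = (1 - r) ^+ 2 by ring.
by rewrite exprn_gt0// subr_gt0.
Qed.

(** With c = a + i b in the closed unit disc this reads (1 + s) |1 - c| <= 2 |1 - s c|, with
    equality at c = -1. *)
Lemma scale_ineq (s a b : R) : 0 <= s -> s < 1 -> -1 <= a ->
  a ^+ 2 + b ^+ 2 <= 1 ->
  (1 + s) ^+ 2 * ((1 - a) ^+ 2 + b ^+ 2) <=
  2 ^+ 2 * ((1 - s * a) ^+ 2 + (s * b) ^+ 2).
Proof.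
move=> s0 s1 a1 ab; rewrite -subr_ge0.
have -> : 2 ^+ 2 * ((1 - s * a) ^+ 2 + (s * b) ^+ 2) -
   (1 + s) ^+ 2 * ((1 - a) ^+ 2 + b ^+ 2) =
   2 * (1 - s) ^+ 2 * (1 + a) + (1 - s) * (3 * s + 1) * (1 - (a ^+ 2 + b ^+ 2)).
  by ring.
apply: addr_ge0.
  by rewrite mulr_ge0 ?mulr_ge0 ?sqr_ge0//; lra.
by rewrite mulr_ge0 ?mulr_ge0//; lra.
Qed.

(** Reduces to [scale_ineq] for s = r^2 and c = conj p q; the extreme case c = -1 is that of
    opposite points on the unit circle. *)
Lemma phdist_scale (r k : R) p q : 0 < r -> r < 1 -> 0 <= k ->
  cabs p <= 1 -> cabs q <= 1 -> phdist_le k p q ->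
  phdist_le (pick_const r * k) (RtoC r * p) (RtoC r * q).
Proof.
move=> r0 r1 k0 p1 q1 pq.
have s0 : 0 < 1 + r ^+ 2 by rewrite addr_gt0// exprn_gt0.
rewrite /phdist_le -mulrBr cabsM cabs_RtoC (gtr0_norm r0).
apply: le_trans (ler_wpM2l (ltW r0) pq) _.
rewrite mulrCA [pick_const _ * k]mulrC -mulrA ler_wpM2l//.
rewrite /pick_const mulrAC ler_pdivlMr// -!mulrA mulrC -!mulrA [leRHS]mulrCA.
rewrite mulrA [_ * r]mulrC ler_wpM2l ?(ltW r0)//.
rewrite -(@ler_pXn2r _ 2)// ?nnegrE ?mulr_ge0 ?cabs_ge0 ?(ltW s0)//.
have [c cE] : exists c, c = cconj p * q by exists (cconj p * q).
have -> : cconj (RtoC r * p) * (RtoC r * q) = RtoC (r ^+ 2) * c.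
  by rewrite cE; apply: cplx_eq; rewrite !(reM, imM, re_cconj, im_cconj)/=; ring.
have c1 : cabs c <= 1 by rewrite cE cabsM cabs_cconj mulr_ile1 ?cabs_ge0.
have c2 : re c ^+ 2 + im c ^+ 2 <= 1.
  by rewrite -cabs_sqr exprn_ile1 ?cabs_ge0.
have ca : -1 <= re c.
  by have := le_trans (re_le _) c1; rewrite ler_norml => /andP[].
have r21 : r ^+ 2 < 1 by rewrite expr_lt1// ltW.
have r20 : 0 < r ^+ 2 by rewrite exprn_gt0.
have := scale_ineq (ltW r20) r21 ca c2.
rewrite -cE !exprMn !cabs_sqr !(reB, imB, reM, imM)/=.
by congr (_ <= _); ring.
Qed.

(** The map z -> c z followed by the automorphism of D that sends 0 to p; c = 0 gives the constant
    disc. *)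
Definition mobius p c z : C := (p + c * z) / (1 + cconj p * (c * z)).

Lemma mobius0 p c : mobius p c 0 = p.
Proof. by rewrite /mobius !mulr0 !addr0 divr1. Qed.

Lemma cabsM_lt1 c z : cabs c <= 1 -> cabs z < 1 -> cabs (c * z) < 1.
Proof.
by move=> c1; apply: le_lt_trans; rewrite cabsM ler_piMl ?cabs_ge0.
Qed.

Lemma mobius_in_disc p c z : cabs p < 1 -> cabs c <= 1 -> cabs z < 1 ->
  cabs (mobius p c z) < 1.
Proof.
move=> p1 c1 z1; have w1 : cabs (- (c * z)) < 1 by rewrite cabsN cabsM_lt1.
have := mobius_lt p1 w1; have := mobius_den p1 (ltW w1).
rewrite mulrN opprK -opprD cabsN => D0.
by rewrite /mobius cabsM cabsV ltr_pdivrMr ?mul1r ?cabs_gt0// addrC.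
Qed.

Lemma derivable_mobius p c z : cabs p < 1 -> cabs c <= 1 -> cabs z < 1 ->
  derivable (mobius p c) z 1.
Proof.
move=> p1 c1 z1; have w1 : cabs (- (c * z)) < 1 by rewrite cabsN cabsM_lt1.
have := mobius_den p1 (ltW w1); rewrite mulrN opprK => D0.
have dcz : derivable (fun z => c * z) z 1.
  by apply: derivableM; [exact: derivable_cst|exact: derivable_id].
apply: (@derivableM _ _ (fun z => p + c * z)
  (fun z => (1 + cconj p * (c * z))^-1)).
  apply: (@derivableD _ _ _ (fun=> p) (fun z => c * z)).
    exact: derivable_cst.
  exact: dcz.
apply: derivable_inv; first exact: D0.
apply: (@derivableD _ _ _ (fun=> 1 : C) (fun z => cconj p * (c * z))).
  exact: derivable_cst.
apply: (@derivableM _ _ (fun=> cconj p) (fun z => c * z)).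
  exact: derivable_cst.
exact: dcz.
Qed.

(** Allowing |c| < 1 lets pairs of points at different distances be joined at the same parameter k,
    so that two coordinates can move along one disc. *)
Lemma mobius_through (k : R) p q : 0 < k -> cabs p < 1 -> cabs q < 1 ->
  phdist_le k p q -> exists2 c, cabs c <= 1 & mobius p c (RtoC k) = q.
Proof.
move=> k0 p1 q1 pq; have D0 := mobius_den p1 (ltW q1).
have P0 := mobius_den p1 (ltW p1).
have k0' : RtoC k != 0 by rewrite -cabs_gt0 cabs_RtoC normr_gt0 lt0r_neq0.
exists ((q - p) / (1 - cconj p * q) / RtoC k).
  rewrite !cabsM !cabsV cabs_RtoC gtr0_norm// ler_pdivrMr// mul1r.
  by rewrite ler_pdivrMr ?cabs_gt0// cabsC.
rewrite /mobius divfK//.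
have E : 1 + cconj p * ((q - p) / (1 - cconj p * q)) =
   (1 - cconj p * p) / (1 - cconj p * q) by field.
have D1 : 1 + cconj p * ((q - p) / (1 - cconj p * q)) != 0.
  by rewrite E mulf_neq0// invr_neq0.
apply: (mulIf D1); rewrite divfK// E; field; exact: D0.
Qed.

(* Schwarz-Pick along an analytic disc through the two points. *)
Lemma phdist_contraction (a : C -> C -> C) (r k : R) x x' y y' :
  0 < r -> r < 1 -> 0 < k -> k < 1 ->
  (forall u v, cabs u < 1 -> cabs v < 1 -> cabs (a u v) < r) ->
  (forall f g, (forall z, cabs z < 1 ->
      [/\ derivable f z 1, derivable g z 1, cabs (f z) < 1 & cabs (g z) < 1]) ->
    forall z, cabs z < 1 -> derivable (fun z => a (f z) (g z)) z 1) ->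
  cabs x < 1 -> cabs x' < 1 -> cabs y < 1 -> cabs y' < 1 ->
  phdist_le k x x' -> phdist_le k y y' ->
  phdist_le (pick_const r * k) (a x y) (a x' y').
Proof.
move=> r0 r1 k0 k1 ar da x1 x1' y1 y1' xx yy.
have [c c1 cE] := mobius_through k0 x1 x1' xx.
have [d d1 dE] := mobius_through k0 y1 y1' yy.
pose h z := a (mobius x c z) (mobius y d z).
have dh z : cabs z < 1 -> derivable h z 1.
  apply: da => w w1.
  by split; do ?[exact: derivable_mobius|exact: mobius_in_disc].
have hr z : cabs z < 1 -> cabs (h z) < r.
  by move=> z1; apply: ar; exact: mobius_in_disc.
have r0' : RtoC r != 0 by rewrite -cabs_gt0 cabs_RtoC normr_gt0 lt0r_neq0.
(* Schwarz-Pick is applied to h / r, which maps D into D; scaling back by r yields the factor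
   [pick_const r]. *)
pose g z := (RtoC r)^-1 * h z.
have g1 z : cabs z < 1 -> cabs (g z) < 1.
  move=> z1; rewrite cabsM cabsV cabs_RtoC (gtr0_norm r0) mulrC.
  by rewrite ltr_pdivrMr// mul1r hr.
have dg z : cabs z < 1 -> derivable g z 1.
  by move=> z1; apply: derivableM; [exact: derivable_cst|exact: dh].
have kC : cabs (RtoC k) = k by rewrite cabs_RtoC gtr0_norm.
have := schwarz_pick dg g1 (_ : cabs (RtoC k) < 1); rewrite kC => /(_ k1) P.
have z0 : cabs (0 : C) < 1 by rewrite cabs0.
have kk : cabs (RtoC k) < 1 by rewrite kC.
have := phdist_scale r0 r1 (ltW k0) (ltW (g1 _ z0)) (ltW (g1 _ kk)) P.
by rewrite /g !mulVKf// /h !mobius0 cE dE.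
Qed.

End SchwarzPick.

(** * Local analysis in two variables *)

Section Local.
Variable R : realType.
Local Notation C := (Cplx R).
Implicit Types (z w p q : C * C) (F : C * C -> C * C).

Definition polyclose (e : R) z w := cabs (w.1 - z.1) < e /\ cabs (w.2 - z.2) < e.

Definition cont_on (A : set (C * C)) F := forall z, A z -> forall e : R, 0 < e ->
  exists2 d : R, 0 < d & forall w, A w -> polyclose d z w -> polyclose e (F z) (F w).

Lemma nbhs_closeP z (A : set (C * C)) :
  nbhs z A <-> exists2 e : R, 0 < e & forall w, polyclose e z w -> A w.
Proof.
split=> [/nbhs_cabs2P[e e0 H]|[e e0 H]].
  by exists e => // w [w1 w2]; exact: H.
by apply/nbhs_cabs2P; exists e => // w w1 w2; exact: H.
Qed.

Lemma polyclose_le (d e : R) z w : d <= e -> polyclose d z w -> polyclose e z w.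
Proof. by move=> de [h1 h2]; split; exact: lt_le_trans de. Qed.

Lemma within_cont_on (A : set (C * C)) F :
  {within A, continuous F} -> cont_on A F.
Proof.
move=> /subspace_continuousP cF z Az e e0.
have : nbhs (F z) [set w | polyclose e (F z) w] by apply/nbhs_closeP; exists e.
move=> /(cF z Az) FA.
have : nbhs z [set w | A w -> polyclose e (F z) (F w)] by exact: FA.
move=> /nbhs_closeP[d d0 H].
by exists d => // w Aw dw; exact: H.
Qed.

Definition has_diff2 (phi : C * C -> C) z (A B : C) := forall e : R, 0 < e ->
  exists2 d : R, 0 < d & forall w, polyclose d z w ->
    cabs (phi w - phi z - A * (w.1 - z.1) - B * (w.2 - z.2)) <=
    e * (cabs (w.1 - z.1) + cabs (w.2 - z.2)).

Lemma prod_norm_le (h : C * C) : `|h| <= RtoC (cabs h.1 + cabs h.2).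
Proof.
rewrite prod_normE normE normE /Order.max; case: ifP => _; rewrite le_RtoC.
  by rewrite lerDr cabs_ge0.
by rewrite lerDl cabs_ge0.
Qed.

Lemma norm1_le (h : C * C) : `|h.1| <= `|h|.
Proof.
rewrite prod_normE !normE /Order.max lt_RtoC; case: ltP => //.
by move/ltW; rewrite le_RtoC.
Qed.

Lemma norm2_le (h : C * C) : `|h.2| <= `|h|.
Proof.
rewrite prod_normE !normE /Order.max lt_RtoC; case: ltP => //.
by rewrite le_RtoC.
Qed.

Lemma differentiable_diff2 F z : differentiable F z ->
  (exists A B, has_diff2 (fun w => (F w).1) z A B) /\
  (exists A B, has_diff2 (fun w => (F w).2) z A B).
Proof.
move=> dF.
suff H : forall e : R, 0 < e -> exists2 d : R, 0 < d & forall w, polyclose d z w ->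
    `|F w - F z - ((w.1 - z.1) *: 'd F z (1, 0) + (w.2 - z.2) *: 'd F z (0, 1))|
    <= RtoC (e * (cabs (w.1 - z.1) + cabs (w.2 - z.2))).
  split; [exists ('d F z (1, 0)).1, ('d F z (0, 1)).1|
          exists ('d F z (1, 0)).2, ('d F z (0, 1)).2] => e e0;
  have [d d0 Hd] := H e e0; exists d => // w /Hd;
  [move/(le_trans (norm1_le _))|move/(le_trans (norm2_le _))];
  rewrite normE le_RtoC /= /GRing.scale/=; congr (cabs _ <= _); ring.
move=> e e0.
have /diff_locallyP[_ /eqaddoP H] := dF.
have /= := H (RtoC e); rewrite -[0]/(RtoC 0) lt_RtoC => /(_ e0).
rewrite near_simpl => /nbhs_closeP[d d0 Hd].
exists d => // w wd; have /= := Hd (w - z).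
rewrite /polyclose/= !subr0 => /(_ wd).
rewrite /= !fctE /= subrK.
have -> : 'd F z (w - z) =
  (w.1 - z.1) *: 'd F z (1, 0) + (w.2 - z.2) *: 'd F z (0, 1).
  have {1}-> : w - z = (w.1 - z.1) *: ((1, 0) : C * C) + (w.2 - z.2) *: (0, 1).
    apply/pair_equal_spec; split;
      by rewrite /= /GRing.scale/= ?mulr1 ?mulr0 ?addr0 ?add0r.
  by rewrite linearD; congr (_ + _); rewrite linearZ.
rewrite opprD addrA => h; apply: (le_trans h).
by rewrite RtoCM ler_wpM2l ?le_RtoC ?(ltW e0)// prod_norm_le.
Qed.

Lemma cderiv_chain2 (phi : C * C -> C) (al be : C -> C) (t A B a b : C) :
  has_diff2 phi (al t, be t) A B -> cderiv al t a -> cderiv be t b ->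
  cderiv (fun u => phi (al u, be u)) t (A * a + B * b).
Proof.
move=> dphi da db e e0.
have A0 := cabs_ge0 A; have B0 := cabs_ge0 B.
have a0 := cabs_ge0 a; have b0 := cabs_ge0 b.
pose K := cabs A + cabs B + cabs a + cabs b + 3.
have K0 : 0 < K by rewrite /K; move: A0 B0 a0 b0; clear; lra.
pose e1 := Num.min 1 (e / K).
have e10 : 0 < e1 by rewrite lt_min ltr01 divr_gt0.
have e11 : e1 <= 1 by rewrite ge_min lexx.
have e1K : e1 * K <= e.
  by rewrite -ler_pdivlMr// ge_min lexx orbT.
have [d1 d10 H1] := dphi e1 e10.
have [d2 d20 H2] := da e1 e10; have [d3 d30 H3] := db e1 e10.
pose L := cabs a + cabs b + 2.
have L0 : 0 < L by rewrite /L; move: a0 b0; clear; lra.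
exists (Num.min (d1 / L) (Num.min d2 d3)).
  by rewrite !lt_min d20 d30 divr_gt0.
move=> u; rewrite !lt_min => /andP[u1 /andP[u2 u3]].
have {}H2 := H2 u u2; have {}H3 := H3 u u3.
have D0 := cabs_ge0 (u - t).
move: u1; rewrite ltr_pdivlMr// => u1.
have la : cabs (al u - al t) <= (cabs a + e1) * cabs (u - t).
  have := cabsD (al u - al t - a * (u - t)) (a * (u - t)).
  by rewrite subrK cabsM; move: H2; clear; lra.
have lb : cabs (be u - be t) <= (cabs b + e1) * cabs (u - t).
  have := cabsD (be u - be t - b * (u - t)) (b * (u - t)).
  by rewrite subrK cabsM; move: H3; clear; lra.
have e1D : e1 * cabs (u - t) <= 1 * cabs (u - t) by rewrite ler_wpM2r.
have aD : 0 <= cabs a * cabs (u - t) by rewrite mulr_ge0.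
have bD : 0 <= cabs b * cabs (u - t) by rewrite mulr_ge0.
have [|{}H1] := (pselect (polyclose d1 (al t, be t) (al u, be u))); last first.
  exfalso; apply: H1; split => /=.
    by move: la u1 e1D aD bD D0; rewrite /L; clear; lra.
  by move: lb u1 e1D aD bD D0; rewrite /L; clear; lra.
move=> /H1 /= {}H1.
have -> : phi (al u, be u) - phi (al t, be t) - (A * a + B * b) * (u - t) =
  (phi (al u, be u) - phi (al t, be t) - A * (al u - al t) - B * (be u - be t))
  + (A * (al u - al t - a * (u - t)) + B * (be u - be t - b * (u - t))) by ring.
apply: le_trans (cabsD _ _) _.
have h4 := cabsD (A * (al u - al t - a * (u - t))) (B * (be u - be t - b * (u - t))).
rewrite !cabsM in h4.
have h5 := ler_wpM2l A0 H2; have h6 := ler_wpM2l B0 H3.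
have h7 : e1 * (cabs (al u - al t) + cabs (be u - be t)) <=
   e1 * ((cabs a + cabs b + 2) * cabs (u - t)).
  by rewrite ler_wpM2l ?(ltW e10)//; move: la lb e1D; clear; lra.
have h8 : e1 * K * cabs (u - t) <= e * cabs (u - t) by rewrite ler_wpM2r.
have h9 : 0 <= e1 * cabs (u - t) by rewrite mulr_ge0 ?(ltW e10).
move: H1 h4 h5 h6 h7 h8 h9; rewrite /K; clear; nra.
Qed.

(* Pointwise implicit function theorem: continuity of the solution is assumed. *)
Lemma cderiv_implicit (phi : C * C -> C) (al be xi : C -> C) (t A B b c : C)
    (d0 : R) : 0 < d0 -> A != 0 ->
  has_diff2 phi (al t, be t) A B -> {for t, continuous al} -> cderiv be t b ->
  cderiv xi t c ->
  (forall u, cabs (u - t) < d0 -> phi (al u, be u) = xi u) ->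
  cderiv al t ((c - B * b) / A).
Proof.
move=> d00 An dphi /continuous_cabsP cal db dxi E e e0.
have A0 : 0 < cabs A by rewrite cabs_gt0.
have B0 := cabs_ge0 B; have b0 := cabs_ge0 b; have c0 := cabs_ge0 c.
(* An a priori Lipschitz constant of [al] at t: since e1 <= |A| / 2, the term e1 |X| is absorbed by
   |A| |X| in the proof of [lX]. *)
pose M := (cabs c + cabs B * cabs b + cabs b + cabs B + 3) * 2 / cabs A.
have M0 : 0 < M.
  apply: divr_gt0 => //.
  have := mulr_ge0 B0 b0; move: B0 b0 c0; clear; lra.
pose K := (M + cabs b + cabs B + 3) / cabs A.
have K0 : 0 < K by apply: divr_gt0 => //; move: B0 b0 M0; clear; lra.
pose e1 := Num.min (Num.min 1 (cabs A / 2)) (e / K).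
have e10 : 0 < e1.
  by rewrite !lt_min ltr01 /=; apply/andP; split; apply: divr_gt0.
have e11 : e1 <= 1 by rewrite !ge_min lexx.
have e1A : e1 <= cabs A / 2 by rewrite !ge_min lexx orbT.
have e1K : e1 * K <= e by rewrite -ler_pdivlMr// ge_min lexx orbT.
have [d1 d10 H1] := dphi e1 e10.
have [d2 d20 H2] := db e1 e10; have [d3 d30 H3] := dxi e1 e10.
have [d4 d40 H4] := cal d1 d10.
pose d5 := d1 / (cabs b + 2).
have b2 : 0 < cabs b + 2 by move: b0; clear; lra.
have d50 : 0 < d5 by apply: divr_gt0.
exists (Num.min (Num.min d2 d3) (Num.min d4 (Num.min d5 d0))).
  by rewrite !lt_min d20 d30 d40 d50 d00.
move=> u; rewrite !lt_min => /andP[/andP[u2 u3] /andP[u4 /andP[u5 u0]]].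
have {}H2 := H2 u u2; have {}H3 := H3 u u3; have {}H4 := H4 u u4.
have Et : phi (al t, be t) = xi t by apply: E; rewrite subrr cabs0.
have D0 := cabs_ge0 (u - t).
move: u5; rewrite ltr_pdivlMr// => u5.
have e1D : e1 * cabs (u - t) <= 1 * cabs (u - t) by rewrite ler_wpM2r.
have bD : 0 <= cabs b * cabs (u - t) by rewrite mulr_ge0.
have lb : cabs (be u - be t) <= (cabs b + 1) * cabs (u - t).
  have := cabsD (be u - be t - b * (u - t)) (b * (u - t)).
  by rewrite subrK cabsM; move: H2 e1D; clear; lra.
have {}H1 : cabs (xi u - xi t - A * (al u - al t) - B * (be u - be t)) <=
    e1 * (cabs (al u - al t) + cabs (be u - be t)).
  rewrite -(E u u0) -Et; apply: H1; split => //=.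
  by move: lb u5 bD D0; clear; lra.
set X := al u - al t in H1 H4 *; set Y := be u - be t in H1 H2 lb *.
set D := u - t in D0 H2 H3 lb e1D bD *; set Z := xi u - xi t in H1 H3 *.
have X0 := cabs_ge0 X.
have key : cabs (A * X - (c - B * b) * D) <=
    e1 * (cabs X + cabs Y) + e1 * cabs D + cabs B * (e1 * cabs D).
  have -> : A * X - (c - B * b) * D =
    - (Z - A * X - B * Y) + (Z - c * D) - B * (Y - b * D) by ring.
  apply: le_trans (cabsB _ _) _; apply: lerD.
    by apply: le_trans (cabsD _ _) _; rewrite cabsN lerD.
  by rewrite cabsM ler_wpM2l.
have BbD : 0 <= cabs B * (cabs b * cabs D) by rewrite !mulr_ge0.
have BD : cabs B * (e1 * cabs D) <= cabs B * (1 * cabs D) by rewrite ler_wpM2l.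
have e1Y : e1 * cabs Y <= 1 * cabs Y by rewrite ler_wpM2r// cabs_ge0.
have lX : cabs X <= M * cabs D.
  have h1 := cabsD (A * X - (c - B * b) * D) ((c - B * b) * D).
  rewrite subrK !cabsM in h1.
  have h2 : cabs (c - B * b) * cabs D <= (cabs c + cabs B * cabs b) * cabs D.
    by rewrite ler_wpM2r// -cabsM cabsB.
  have h3 : e1 * cabs X <= cabs A / 2 * cabs X by rewrite ler_wpM2r.
  rewrite /M mulrAC ler_pdivlMr//.
  move: h1 h2 h3 key BD e1Y lb e1D D0; clear; nra.
have An1 : 0 < (cabs A)^-1 by rewrite invr_gt0.
have -> : X - (c - B * b) / A * D = (A * X - (c - B * b) * D) / A by field.
rewrite cabsM cabsV ler_pdivrMr//.
have h1 : e1 * K * cabs D <= e * cabs D by rewrite ler_wpM2r.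
have h2 : e1 * cabs X <= e1 * (M * cabs D) by rewrite ler_wpM2l// ltW.
have h3 : e1 * cabs Y <= e1 * ((cabs b + 1) * cabs D) by rewrite ler_wpM2l// ltW.
have h4 : e1 * (M + cabs b + cabs B + 3) * cabs D <= e * cabs D * cabs A.
  have := ler_wpM2r (ltW A0) h1; rewrite /K.
  have -> : e1 * ((M + cabs b + cabs B + 3) / cabs A) * cabs D * cabs A =
    e1 * (M + cabs b + cabs B + 3) * cabs D.
    by field; exact: lt0r_neq0.
  by [].
have h5 : 0 <= e1 * cabs D by rewrite mulr_ge0// ltW.
move: key h2 h3 h4 h5; clear; nra.
Qed.

End Local.

(** * Compactness, segments and limits *)

Section Misc.
Variable R : realType.
Local Notation C := (Cplx R).

(** Finitely many local radii have a positive minimum, and P passes to smaller radii. *)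
Lemma compact_uniform (T : topologicalType) (K : set T) (P : R -> T -> Prop) :
  compact K -> (forall d e x, d <= e -> P e x -> P d x) ->
  (forall x, K x -> exists2 e : R, 0 < e & nbhs x [set y | P e y]) ->
  exists2 e : R, 0 < e & forall x, K x -> P e x.
Proof.
move=> /compact_near_coveringP cK mono loc.
have /filter_ex[e [e0 He]] : \forall e \near 0^'+, 0 < e /\ K `<=` P e.
  near=> e; split; first by near: e; exact: nbhs_right_gt.
  near: e; apply: cK => x Kx; have [e0 e00 H] := loc x Kx.
  exists ([set y | P e0 y], [set e | e < e0]).
    by split => //=; exact: nbhs_right_lt.
  by move=> [y e] [/= h1 h2]; apply: mono h1; exact: ltW.
by exists e => // x Kx; exact: He.
Unshelve. all: by end_near. Qed.

(** Connectedness of [0, 1]: the set where P holds is relatively open and closed. *)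
Lemma segment_induction (P : R -> Prop) : P 0 ->
  (forall s : R, 0 <= s <= 1 -> P s -> exists2 d : R, 0 < d &
     forall u : R, 0 <= u <= 1 -> `|u - s| < d -> P u) ->
  (forall s : R, 0 <= s <= 1 -> ~ P s -> exists2 d : R, 0 < d &
     forall u : R, 0 <= u <= 1 -> `|u - s| < d -> ~ P u) ->
  P 1.
Proof.
move=> P0 oP cP.
have itvE (s : R) : [set` `[0, 1]] s <-> 0 <= s <= 1 by rewrite /= in_itv.
have intP (Q : R -> Prop) (s : R) : 0 <= s <= 1 ->
   (exists2 d : R, 0 < d & forall u : R, 0 <= u <= 1 -> `|u - s| < d -> Q u) ->
   interior [set s : R | 0 <= s <= 1 -> Q s] s.
  move=> s01 [d d0 H]; apply/nbhs_ballP; exists d => // u.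
  by rewrite /ball/= distrC => us u01; exact: H.
have E : [set s : R | 0 <= s <= 1 /\ P s] = `[0, 1]%classic.
  apply: segment_connected.
  - by exists 0; rewrite /= lexx ler01.
  - exists (interior [set s | 0 <= s <= 1 -> P s]); first exact: open_interior.
    apply/seteqP; split=> s /=.
      by move=> [s01 Ps]; split; [exact/itvE|apply: intP => //; exact: oP].
    by move=> [/itvE s01 /interior_subset H]; split=> //; exact: H.
  - exists (~` interior [set s | 0 <= s <= 1 -> ~ P s]).
      by apply: open_closedC; exact: open_interior.
    apply/seteqP; split=> s /=.
      move=> [s01 Ps]; split; first exact/itvE.
      by move=> /interior_subset /(_ s01).
    move=> [/itvE s01 H]; split => //; apply: contrapT => nPs.
    by apply: H; apply: intP => //; exact: cP.
have : [set` `[0 : R, 1]] 1 by apply/itvE; rewrite ler01 lexx.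
by rewrite -E => -[].
Qed.

(** Real and imaginary parts lie in nested intervals whose half-width c / (1 - k) k^n is the tail of
    the geometric series; adding the two bounds gives the factor 2. *)
Lemma geometric_limit (u : nat -> C) (c k : R) : 0 <= c -> 0 <= k -> k < 1 ->
  (forall n, cabs (u n.+1 - u n) <= c * k ^+ n) ->
  exists l, forall n, cabs (u n - l) <= 2 * (c / (1 - k) * k ^+ n).
Proof.
move=> c0 k0 k1 H; have k1' : 0 < 1 - k by rewrite subr_gt0.
have real_case (v : nat -> R) : (forall n, `|v n.+1 - v n| <= c * k ^+ n) ->
    exists l, forall n, `|v n - l| <= c / (1 - k) * k ^+ n.
  move=> Hv; pose e n := c / (1 - k) * k ^+ n.
  have e0 n : 0 <= e n by rewrite mulr_ge0 ?exprn_ge0// divr_ge0// ltW.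
  have eS n : e n - e n.+1 = c * k ^+ n.
    by rewrite /e exprS; field; exact: lt0r_neq0.
  have [||| l Hl] := @nested_itv R (fun n => v n - e n) (fun n => v n + e n).
  - by move=> n; have := Hv n; rewrite -eS ler_norml => /andP[]; lra.
  - by move=> n; have := Hv n; rewrite -eS ler_norml => /andP[]; lra.
  - by move=> n; have := e0 n; lra.
  exists l => n; have /andP[h1 h2] := Hl n.
  by rewrite -/(e n) ler_norml; apply/andP; split; lra.
have [a Ha] : exists a, forall n, `|re (u n) - a| <= c / (1 - k) * k ^+ n.
  by apply: real_case => n; rewrite -reB; exact: le_trans (re_le _) (H n).
have [b Hb] : exists b, forall n, `|im (u n) - b| <= c / (1 - k) * k ^+ n.
  by apply: real_case => n; rewrite -imB; exact: le_trans (im_le _) (H n).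
exists (cplx a b) => n; apply: le_trans (cabs_le _) _; rewrite reB imB/=.
by have := Ha n; have := Hb n; lra.
Qed.

Lemma exists_exp_lt (k e : R) : 0 <= k -> k < 1 -> 0 < e ->
  exists n, k ^+ n < e.
Proof.
move=> k0 k1 e0.
have kk : `|k| < 1 by rewrite ger0_norm.
have := cvg_expr kk => /cvgrPdist_lt /(_ e e0) [N _ H].
exists N; have := H N (leqnn N); rewrite sub0r normrN ger0_norm//.
exact: exprn_ge0.
Qed.

Lemma seq_separated (s : seq C) (p : C) : exists2 d : R, 0 < d &
  forall x, x \in s -> x != p -> d <= cabs (x - p).
Proof.
elim: s => [|y s [d d0 IH]]; first by exists 1.
have [yp|yp] := eqVneq y p.
  exists d => // x; rewrite inE => /orP[/eqP -> /eqP//|]; exact: IH.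
exists (Num.min d (cabs (y - p))); first by rewrite lt_min d0 cabs_gt0 subr_eq0.
move=> x; rewrite inE => /orP[/eqP -> _|xs xp]; rewrite ge_min.
  by rewrite lexx orbT.
by rewrite IH.
Qed.

Lemma mult_cderiv (f : C -> C) (x : C) : multiplicity_at f x 1 ->
  exists2 A, A != 0 & cderiv f x A.
Proof.
move=> [g [dg gx fE]]; exists (g x) => // e e0.
have /derivable_cderiv[B gB] := nbhs_singleton dg.
have /continuous_cabsP cg := cderiv_continuous gB.
have [d d0 Hd] := cg e e0.
move/nbhs_cabsP: fE => [d' d'0 fE].
exists (Num.min d d'); first by rewrite lt_min d0.
move=> w; rewrite lt_min => /andP[/Hd h1 /fE ->].
have -> : f x + (w - x) ^+ 1 * g w - f x - g x * (w - x) =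
  (g w - g x) * (w - x) by rewrite expr1; ring.
by rewrite cabsM ler_wpM2r ?cabs_ge0// ltW.
Qed.

Lemma mult_gt0 (f : C -> C) (x : C) e : multiplicity_at f x e -> (0 < e)%N.
Proof.
case: e => // -[g [_ gx /nbhs_singleton]].
rewrite expr0 mul1r -[LHS]addr0 => /addrI g0.
by rewrite -g0 eqxx in gx.
Qed.

Lemma sum_ones (T : eqType) (s : seq T) (e : T -> nat) :
  (forall x, x \in s -> (0 < e x)%N) -> (\sum_(x <- s) e x <= size s)%N ->
  forall x, x \in s -> e x = 1%N.
Proof.
elim: s => // y s IH e0; rewrite big_cons /= => h.
have le_s : (size s <= \sum_(x <- s) e x)%N.
  rewrite -sum1_size big_seq [leqRHS]big_seq; apply: leq_sum => x xs.
  by apply: e0; rewrite inE xs orbT.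
have ey : (0 < e y)%N by apply: e0; rewrite inE eqxx.
move=> x; rewrite inE => /orP[/eqP ->|xs].
  by apply/eqP; rewrite eqn_leq ey andbT; lia.
apply: IH => //; first by move=> z zs; apply: e0; rewrite inE zs orbT.
lia.
Qed.

Lemma sum_ge_size (T : eqType) (s : seq T) (e : T -> nat) :
  (forall x, x \in s -> (0 < e x)%N) -> (size s <= \sum_(x <- s) e x)%N.
Proof.
move=> e0; rewrite -sum1_size big_seq [leqRHS]big_seq.
by apply: leq_sum => x xs; exact: e0.
Qed.

Definition seg (x0 x1 : C) (s : R) : C := x0 + RtoC s * (x1 - x0).

Lemma RtoC1 : RtoC (1 : R) = 1. Proof. by []. Qed.
Lemma RtoC0 : RtoC (0 : R) = 0. Proof. by []. Qed.
Lemma RtoCB (a b : R) : RtoC (a - b) = RtoC a - RtoC b.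
Proof. by apply: cplx_eq; rewrite ?reB ?imB//= subrr. Qed.

Lemma seg_0 x0 x1 : seg x0 x1 0 = x0.
Proof. by rewrite /seg RtoC0 mul0r addr0. Qed.
Lemma seg_1 x0 x1 : seg x0 x1 1 = x1.
Proof. by rewrite /seg RtoC1 mul1r addrC subrK. Qed.

Lemma seg_disc x0 x1 s : disc x0 -> disc x1 -> 0 <= s <= 1 -> disc (seg x0 x1 s).
Proof.
move=> /discE a1 /discE b1 /andP[s0 s1]; apply/discE.
have -> : seg x0 x1 s = RtoC (1 - s) * x0 + RtoC s * x1.
  by rewrite RtoCB RtoC1 /seg; ring.
apply: le_lt_trans (cabsD _ _) _; rewrite !cabsM !cabs_RtoC !ger0_norm ?subr_ge0//.
move: a1 b1; set a := cabs x0; set b := cabs x1 => a1 b1.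
have m1 : Num.max a b < 1 by rewrite gt_max a1.
have h1 : (1 - s) * a <= (1 - s) * Num.max a b.
  by rewrite ler_wpM2l ?subr_ge0// le_max lexx.
have h2 : s * b <= s * Num.max a b by rewrite ler_wpM2l// le_max lexx orbT.
by apply: le_lt_trans m1; apply: le_trans (lerD h1 h2) _; rewrite -mulrDl subrK mul1r.
Qed.

Lemma seg_close x0 x1 s (e : R) : 0 < e -> exists2 d : R, 0 < d &
  forall u, `|u - s| < d -> cabs (seg x0 x1 u - seg x0 x1 s) < e.
Proof.
move=> e0; have D0 : 0 < cabs (x1 - x0) + 1 by rewrite ltr_wpDl ?cabs_ge0.
exists (e / (cabs (x1 - x0) + 1)); first exact: divr_gt0.
move=> u; rewrite ltr_pdivlMr//; apply: le_lt_trans.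
have -> : seg x0 x1 u - seg x0 x1 s = RtoC (u - s) * (x1 - x0).
  by rewrite RtoCB /seg; ring.
by rewrite cabsM cabs_RtoC ler_wpM2l// lerDl.
Qed.

End Misc.

(** * Coding a horizontal horseshoe *)

Section Horseshoe.
Variables (R : realType) (d : nat).
Local Notation C := (Cplx R).
Variables (F G : C * C -> C * C) (lab : C * C -> 'I_d).
Local Notation B := (@bidisc R).
Local Notation cB := (@closed_bidisc R).

Lemma closed_bidiscE (z : C * C) : cB z <-> cabs z.1 <= 1 /\ cabs z.2 <= 1.
Proof. by split=> -[/closed_discE h1 /closed_discE h2]. Qed.
Lemma bidiscE (z : C * C) : B z <-> cabs z.1 < 1 /\ cabs z.2 < 1.
Proof. by split=> -[/discE h1 /discE h2]. Qed.
Lemma bidisc_closed (z : C * C) : B z -> cB z.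
Proof. by move=> /bidiscE[h1 h2]; apply/closed_bidiscE; split; exact: ltW. Qed.

Lemma not_closed_bidisc_near (z : C * C) : ~ cB z ->
  exists2 e : R, 0 < e & forall w, polyclose e z w -> ~ cB w.
Proof.
move=> nz; apply/nbhs_closeP; apply: open_nbhs_nbhs; split => //.
exact/closed_openC/closed_closed_bidisc.
Qed.

Lemma bidisc_near (z : C * C) : B z ->
  exists2 e : R, 0 < e & forall w, polyclose e z w -> B w.
Proof.
move=> /bidiscE[z1 z2]; exists (Num.min (1 - cabs z.1) (1 - cabs z.2)).
  by rewrite lt_min !subr_gt0 z1.
move=> w []; rewrite !lt_min => /andP[h1 _] /andP[_ h2].
apply/bidiscE; split.
  by have := cabsD (w.1 - z.1) z.1; rewrite subrK; move: h1; lra.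
by have := cabsD (w.2 - z.2) z.2; rewrite subrK; move: h2; lra.
Qed.

Lemma cderiv_id (t : C) : cderiv id t 1.
Proof.
by move=> e e0; exists 1 => // w _; rewrite mul1r subrr cabs0 mulr_ge0 ?(ltW e0)// cabs_ge0.
Qed.

Lemma cderiv_cst (c t : C) : cderiv (fun=> c) t 0.
Proof.
by move=> e e0; exists 1 => // w _; rewrite mul0r !subrr cabs0 mulr_ge0 ?(ltW e0)// cabs_ge0.
Qed.

Lemma cderiv_unique (f : C -> C) (t A A' : C) :
  cderiv f t A -> cderiv f t A' -> A = A'.
Proof.
by move=> /cderiv_is_derive[_ <-] /cderiv_is_derive[_ <-].
Qed.

Hypothesis FG : forall z, cB z -> cB (G z) -> F (G z) = z.
Hypothesis GF : forall z, cB z -> cB (F z) -> G (F z) = z.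
Hypothesis cF : cont_on cB F.
Hypothesis cG : cont_on cB G.
Hypothesis dF : forall z, B z ->
  (exists P Q, has_diff2 (fun w => (F w).1) z P Q) /\
  (exists P Q, has_diff2 (fun w => (F w).2) z P Q).
Hypothesis hF : horizontal F.
Hypothesis fib : forall y, disc y ->
  fibers_count (fun t => (F (t, y)).1) [set t | disc t /\ B (F (t, y))] d.
Hypothesis lab_loc : forall w, B w -> B (G w) -> exists2 e : R, 0 < e &
  forall w', B w' -> B (G w') -> polyclose e w w' -> lab w' = lab w.
Hypothesis lab_full : forall i y, disc y ->
  exists t, [/\ disc t, B (F (t, y)) & lab (F (t, y)) = i].

(** Horizontality excludes |z.1| = 1 and |(F z).2| = 1 when z and F z are in the closed bidisc;
    compactness makes both bounds uniform. Points whose image leaves the closed bidisc keep doing so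
    nearby and impose nothing. *)
Lemma crossing_bound : exists2 r : R, 0 < r < 1 &
  forall z, cB z -> cB (F z) -> cabs z.1 < r /\ cabs (F z).2 < r.
Proof.
pose P (e : R) z := cB z -> cB (F z) -> cabs z.1 < 1 - e /\ cabs (F z).2 < 1 - e.
have [||e e0 H] := @compact_uniform R _ cB P (@compact_closed_bidisc R).
- move=> e e' z ee' Pz cz cFz; have [h1 h2] := Pz cz cFz.
  by split; move: h1 h2; lra.
- move=> z cz; have [cFz|ncFz] := pselect (cB (F z)); last first.
    have [e e0 He] := not_closed_bidisc_near ncFz.
    have [de de0 Hd] := cF cz e0.
    exists 1 => //; apply/nbhs_closeP; exists de => // w dw cw cFw.
    by case: (He (F w)) => //; exact: Hd.
  have /closed_bidiscE[z1 z2] := cz; have /closed_bidiscE[f1 f2] := cFz.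
  have z1' : cabs z.1 < 1.
    rewrite lt_neqAle z1 andbT; apply/eqP => z1'.
    have : (cB `&` F @` boundary_V (R:=R)) (F z).
      split => //; exists z => //; split; first exact/circleE.
      exact/closed_discE.
    by rewrite hF.2.
  have f2' : cabs (F z).2 < 1.
    rewrite lt_neqAle f2 andbT; apply/eqP => f2'.
    have : (F @` cB `&` boundary_H (R:=R)) (F z).
      split; first by exists z.
      by split; [exact/closed_discE|exact/circleE].
    by rewrite hF.1.
  pose e := Num.min ((1 - cabs z.1) / 2) ((1 - cabs (F z).2) / 2).
  have e0 : 0 < e by rewrite lt_min !divr_gt0 ?subr_gt0.
  have e1 : e <= (1 - cabs z.1) / 2 by rewrite ge_min lexx.
  have e2 : e <= (1 - cabs (F z).2) / 2 by rewrite ge_min lexx orbT.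
  exists e => //; have [de de0 Hd] := cF cz e0.
  apply/nbhs_closeP; exists (Num.min e de); first by rewrite lt_min e0.
  move=> w dw cw cFw.
  have de1 : Num.min e de <= e by rewrite ge_min lexx.
  have de2 : Num.min e de <= de by rewrite ge_min lexx orbT.
  have [w1 _] := polyclose_le de1 dw.
  have [_ w2] := Hd w cw (polyclose_le de2 dw).
  split.
    by have := cabsD (w.1 - z.1) z.1; rewrite subrK; move: w1 e1; lra.
  have := cabsD ((F w).2 - (F z).2) (F z).2; rewrite subrK.
  by move: w2 e2; lra.
(* The maximum with 1/2 keeps the bound positive, as e may exceed 1. *)
exists (Num.max (1 - e) (1 / 2)).
  by rewrite lt_max gt_max; apply/andP; split; [apply/orP; right|apply/andP; split]; lra.
by move=> z cz cFz; have [h1 h2] := H z cz cz cFz; rewrite !lt_max h1 h2.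
Qed.

(** * Crossings of horizontal slices with the pieces of B n F(B) *)

Variable r : R.
Hypothesis r_gt0 : 0 < r.
Hypothesis r_lt1 : r < 1.
Hypothesis r_bound : forall z, cB z -> cB (F z) ->
  cabs z.1 < r /\ cabs (F z).2 < r.

(* F sends the point of abscissa t of H_y into the i-th piece, above x. *)
Definition crossing i (x y t : C) :=
  [/\ disc t, B (F (t, y)), lab (F (t, y)) = i & (F (t, y)).1 = x].

(** Upper semicontinuity of the set of crossings, by compactness of the closed disc. With O empty,
    absence of crossings is an open condition; with O a small disc, a unique crossing depends
    continuously on (x, y). *)
Lemma crossing_near i (x0 y0 : C) (O : set C) : disc x0 -> disc y0 ->
  (forall t, O t -> exists2 e : R, 0 < e & forall u, cabs (u - t) < e -> O u) ->
  (forall t, crossing i x0 y0 t -> O t) ->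
  exists2 e : R, 0 < e & forall x y, cabs (x - x0) < e -> cabs (y - y0) < e ->
    disc y -> forall t, crossing i x y t -> O t.
Proof.
move=> x01 y01 oO sO.
pose P (e : R) (t : C) := forall x y, cabs (x - x0) < e -> cabs (y - y0) < e ->
  disc y -> crossing i x y t -> O t.
have [||e e0 H] := @compact_uniform R _ (@closed_disc R) P (@compact_closed_disc R).
- move=> e e' t ee' Pt x y xe ye; apply: Pt; exact: lt_le_trans ee'.
- move=> t0 ct0.
  have ct : cB (t0, y0) by split => //; apply/closed_discE/ltW/discE.
  (* By [r_bound] a boundary parameter t0 cannot be sent above x0 inside the closed bidisc, so no
     crossing escapes through the boundary. Otherwise t0 is excluded nearby by its label, by leaving
     the bidisc, or by lying above another abscissa. *)
  have [[cFt Fx]|nFt] := pselect (cB (F (t0, y0)) /\ (F (t0, y0)).1 = x0).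
    have [t0r Fr] := r_bound ct cFt.
    have t01 : disc t0 by apply/discE; exact: lt_trans r_lt1.
    have BF : B (F (t0, y0)).
      apply/bidiscE; split; first by rewrite Fx; exact/discE.
      exact: lt_trans r_lt1.
    have [labi|labi] := eqVneq (lab (F (t0, y0))) i.
      have [e e0 He] := oO t0 (sO t0 (And4 t01 BF labi Fx)).
      exists 1 => //; apply/nbhs_cabsP; exists e => // t te x y _ _ _ _.
      exact: He.
    have BG : B (G (F (t0, y0))) by rewrite GF.
    have [e e0 He] := lab_loc BF BG.
    have [de de0 Hd] := cF ct e0.
    exists de => //; apply/nbhs_cabsP; exists de => // t td x y _ yd y1.
    case=> t1 BFt labt _; exfalso; move/eqP: labi; apply.
    have cty : cB (t, y) by apply: bidisc_closed.
    rewrite -labt; apply/esym/He => //; last exact: Hd.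
    by rewrite GF//; exact: bidisc_closed.
  have [cFt|ncFt] := pselect (cB (F (t0, y0))); last first.
    have [e e0 He] := not_closed_bidisc_near ncFt.
    have [de de0 Hd] := cF ct e0.
    exists de => //; apply/nbhs_cabsP; exists de => // t td x y _ yd y1.
    case=> t1 BFt _ _; exfalso; apply: (He (F (t, y))).
      by apply: Hd => //; apply: bidisc_closed.
    exact: bidisc_closed.
  have Fx : (F (t0, y0)).1 != x0 by apply/eqP => Fx; apply: nFt.
  pose e := cabs ((F (t0, y0)).1 - x0) / 2.
  have e0 : 0 < e by rewrite divr_gt0// cabs_gt0 subr_eq0.
  have [de de0 Hd] := cF ct e0.
  have m0 : 0 < Num.min e de by rewrite lt_min e0.
  exists (Num.min e de) => //; apply/nbhs_cabsP; exists de => // t td x y.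
  rewrite !lt_min => /andP[xe _] /andP[_ yd] y1 [t1 BFt _ Ftx]; exfalso.
  have cty : cB (t, y) by apply: bidisc_closed.
  have [//|+ _] := Hd (t, y) cty; rewrite Ftx.
  have := cabsD ((F (t0, y0)).1 - x) (x - x0); rewrite addrA subrK cabsC.
  by move: xe; rewrite /e; lra.
by exists e => // x y xe ye y1 t st; apply: (H t _ x y) => //; case: st => /discE/ltW/closed_discE.
Qed.

Lemma derivable_slice (t y : C) : B (t, y) ->
  exists2 P, (exists Q, has_diff2 (fun w => (F w).1) (t, y) P Q) &
    cderiv (fun t => (F (t, y)).1) t P.
Proof.
move=> /dF[[P [Q PQ]] _]; exists P; first by exists Q.
have := @cderiv_chain2 _ _ id (fun=> y) t P Q 1 0 PQ (cderiv_id t) (cderiv_cst y t).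
by rewrite mulr1 mulr0 addr0.
Qed.

Lemma crossing_local i (x0 y t0 : C) : disc y -> crossing i x0 y t0 ->
  exists2 e : R, 0 < e & forall t, cabs (t - t0) < e ->
    [/\ disc t, B (F (t, y)) & lab (F (t, y)) = i].
Proof.
move=> y1 [t01 BF labi Fx].
have Bt : B (t0, y) by [].
have [e1 e10 H1] := bidisc_near BF.
have BG : B (G (F (t0, y))) by rewrite GF//; exact: bidisc_closed.
have [e2 e20 H2] := lab_loc BF BG.
have m0 : 0 < Num.min e1 e2 by rewrite lt_min e10.
have [e3 e30 H3] := cF (bidisc_closed Bt) m0.
have [e4 e40 H4] := bidisc_near Bt.
exists (Num.min e3 e4); first by rewrite lt_min e30.
move=> t; rewrite lt_min => /andP[t3 t4].
have Bty : B (t, y) by apply: H4; split; rewrite //= subrr cabs0.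
have ct : polyclose (Num.min e1 e2) (F (t0, y)) (F (t, y)).
  apply: H3; first exact: bidisc_closed.
  by split; rewrite //= subrr cabs0.
have BFt : B (F (t, y)).
  by apply: H1; apply: polyclose_le ct; rewrite ge_min lexx.
split; [by case: Bty|exact: BFt|rewrite -labi; apply: H2 => //].
  by rewrite GF//; exact: bidisc_closed.
by apply: polyclose_le ct; rewrite ge_min lexx orbT.
Qed.

(** The fibre above x0 is finite, so t0 is isolated in it and [isolated_open] applies. *)
Lemma crossing_open i (x0 y t0 : C) : disc y -> crossing i x0 y t0 ->
  exists2 e : R, 0 < e & forall x, cabs (x - x0) < e -> exists t, crossing i x y t.
Proof.
move=> y1 st; have [e1 e10 H1] := crossing_local y1 st.
have [t01 BF labi Fx] := st.
have x01 : disc x0 by rewrite -Fx; case: BF.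
have [s [m [_ sP _ _]]] := fib y1 x01.
have [e2 e20 H2] := seq_separated s t0.
pose e := Num.min e1 e2.
have e0 : 0 < e by rewrite lt_min e10.
have [||de de0 Hd] := @isolated_open R (fun t => (F (t, y)).1) t0 e e0.
- move=> t; rewrite lt_min => /andP[/H1[t1 _ _] _].
  have [|P _ HP] := @derivable_slice t y; first by [].
  by apply/derivable_cderivP; exists P.
- move=> t; rewrite cabs_gt0 subr_eq0 => tt0; rewrite lt_min => /andP[t1 t2].
  apply/eqP => ft; have [td BFt _] := H1 t t1.
  have ts : t \in s by apply/sP; split => //=; rewrite ft.
  by have := H2 t ts tt0; rewrite leNgt t2.
rewrite Fx in Hd; exists de => // x /Hd[t]; rewrite lt_min => /andP[/H1[h1 h2 h3] _] h4.
by exists t.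
Qed.

(** Along the segment from the abscissa of one known crossing to x, existence is an open condition
    by [crossing_open] and a closed one by [crossing_near] with O empty. *)
Lemma crossing_exists i (x y : C) : disc x -> disc y -> exists t, crossing i x y t.
Proof.
move=> x1 y1; have [t0 [t01 BF0 lab0]] := lab_full i y1.
pose x0 := (F (t0, y)).1.
have x01 : disc x0 by case: BF0.
rewrite -(seg_1 x0 x).
apply: (@segment_induction R (fun s => exists t, crossing i (seg x0 x s) y t)).
- by exists t0; rewrite seg_0.
- move=> s s01 [t st]; have [e e0 H] := crossing_open y1 st.
  have [de de0 Hd] := seg_close x0 x s e0.
  by exists de => // u _ /Hd; exact: H.
- move=> s s01 ns; have c1 := seg_disc x01 x1 s01.
  have [//|t st|e e0 H] := @crossing_near i (seg x0 x s) y set0 c1 y1.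
    by apply: ns; exists t.
  have [de de0 Hd] := seg_close x0 x s e0.
  exists de => // u _ /Hd us [t st]; apply: (H _ y us _ y1 t st).
  by rewrite subrr cabs0.
Qed.

(* Each of the d pieces meets the fibre, whose total multiplicity is d. *)
Lemma crossing_simple (x y : C) : disc x -> disc y ->
  (forall i t t', crossing i x y t -> crossing i x y t' -> t = t') /\
  (forall i t, crossing i x y t -> exists2 A, A != 0 &
     cderiv (fun t => (F (t, y)).1) t A).
Proof.
move=> x1 y1; have [s [m [us sP mP sm]]] := fib y1 x1.
have /choice[T TP] : forall i, exists t, crossing i x y t.
  by move=> i; exact: crossing_exists.
have insol i t : crossing i x y t -> t \in s.
  by case=> h1 h2 _ h4; apply/sP.
have Tinj : injective T.
  by move=> i j E; have [_ _ <- _] := TP i; have [_ _ <- _] := TP j; rewrite E.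
(* These are d distinct points of the fibre, each of multiplicity at least 1 in a total of d: they
   exhaust the fibre and every multiplicity is 1. *)
pose l := [seq T i | i <- enum 'I_d].
have ul : uniq l by rewrite map_inj_uniq// enum_uniq.
have sl : size l = d by rewrite size_map size_enum_ord.
have ls : {subset l <= s} by move=> t /mapP[i _ ->]; exact: insol (TP i).
have m0 t : t \in s -> (0 < m t)%N by move=> /mP/mult_gt0.
have ds : (size s <= size l)%N by rewrite sl -{1}sm; exact: sum_ge_size.
have [_ sl_eq] := uniq_min_size ul ls ds.
have m1 : forall t, t \in s -> m t = 1%N.
  by apply: sum_ones => //; rewrite sm -sl; exact: uniq_leq_size.
have solT i t : crossing i x y t -> t = T i.
  move=> st; have := insol i t st; rewrite -sl_eq => /mapP[j _ tj].
  have [_ _ Ej _] := TP j; case: st => _ _ Ei _.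
  by rewrite tj in Ei *; congr T; rewrite -Ei Ej.
split; first by move=> i t t' /solT -> /solT ->.
by move=> i t /insol ts; apply: mult_cderiv; rewrite -(m1 t ts); exact: mP.
Qed.

(* Cross form of the i-th branch: F (crossA i x y, y) = (x, crossB i x y). *)
Definition crossA i x y : C := xget 0 [set t | crossing i x y t].
Definition crossB i x y : C := (F (crossA i x y, y)).2.

Lemma crossAP i x y : disc x -> disc y -> crossing i x y (crossA i x y).
Proof.
by move=> x1 y1; apply: (@xgetPex _ 0 [set t | crossing i x y t]); exact: crossing_exists.
Qed.

Lemma crossA_unique i x y t : disc x -> disc y -> crossing i x y t ->
  t = crossA i x y.
Proof.
move=> x1 y1 st; have [H _] := crossing_simple x1 y1.
exact: H st (crossAP i x1 y1).
Qed.

Lemma cross_lt i x y : disc x -> disc y ->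
  cabs (crossA i x y) < r /\ cabs (crossB i x y) < r.
Proof.
move=> x1 y1; have [t1 BF _ _] := crossAP i x1 y1.
have Bt : B (crossA i x y, y) by [].
exact: (r_bound (bidisc_closed Bt) (bidisc_closed BF)).
Qed.

Definition analytic_disc (f g : C -> C) := forall z, cabs z < 1 ->
  [/\ derivable f z 1, derivable g z 1, cabs (f z) < 1 & cabs (g z) < 1].

(* Continuity comes from compactness and uniqueness of crossings; simplicity of
   the crossing then makes the implicit function theorem applicable. *)
Lemma derivable_crossA i (f g : C -> C) : analytic_disc f g ->
  forall z, cabs z < 1 -> derivable (fun z => crossA i (f z) (g z)) z 1.
Proof.
move=> fg z z1; pose al w := crossA i (f w) (g w).
have fg1 w : cabs w < 1 -> disc (f w) /\ disc (g w).
  by move=> /fg[_ _ h1 h2]; split; exact/discE.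
have sP w : cabs w < 1 -> crossing i (f w) (g w) (al w).
  by move=> /fg1[h1 h2]; exact: crossAP.
have [/derivable_cderiv[f' f'P] /derivable_cderiv[g' g'P] _ _] := fg z z1.
have [f1 g1] := fg1 z z1.
have z10 : 0 < 1 - cabs z by rewrite subr_gt0.
have in_disc w : cabs (w - z) < 1 - cabs z -> cabs w < 1.
  by have := cabsD (w - z) z; rewrite subrK; lra.
have cal : {for z, continuous al}.
  apply/continuous_cabsP => e e0.
  have [||e1 e10 H] := @crossing_near i (f z) (g z) [set t | cabs (t - al z) < e] f1 g1.
  - move=> t /= te; exists (e - cabs (t - al z)); first by rewrite subr_gt0.
    by move=> u; have := cabsD (u - t) (t - al z); rewrite addrA subrK; lra.
  - by move=> t /(crossA_unique f1 g1) ->; rewrite /= subrr cabs0.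
  have /continuous_cabsP/(_ e1 e10)[d1 d10 H1] := cderiv_continuous f'P.
  have /continuous_cabsP/(_ e1 e10)[d2 d20 H2] := cderiv_continuous g'P.
  exists (Num.min (1 - cabs z) (Num.min d1 d2)); first by rewrite !lt_min d10 d20 z10.
  move=> w; rewrite !lt_min => /andP[/in_disc w1 /andP[/H1 h1 /H2 h2]].
  by apply: (H _ _ h1 h2 _ _ (sP w w1)); exact: (fg1 w w1).2.
have [tz BFz _ _] := sP z z1.
have Bz : B (al z, g z) by split=> //=.
have [P [Q PQ] HP] := derivable_slice Bz.
(* At a simple crossing the derivative along the slice is nonzero, and it equals the first partial
   derivative P. *)
have [_ /(_ _ _ (sP z z1))[P' P'0 HP']] := crossing_simple f1 g1.
have P0 : P != 0 by rewrite (cderiv_unique HP HP').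
apply/derivable_cderivP; eexists.
apply: (@cderiv_implicit _ _ al g f z P Q g' f' _ z10 P0 PQ cal g'P f'P).
by move=> u /in_disc /sP[].
Qed.

Lemma derivable_crossB i (f g : C -> C) : analytic_disc f g ->
  forall z, cabs z < 1 -> derivable (fun z => crossB i (f z) (g z)) z 1.
Proof.
move=> fg z z1; have [_ + h1 h2] := fg z z1.
move=> /derivable_cderiv[g' g'P].
have /derivable_cderiv[a' a'P] := @derivable_crossA i f g fg z z1.
have [tz _ _ _] : crossing i (f z) (g z) (crossA i (f z) (g z)).
  by apply: crossAP; exact/discE.
have [|_ [P [Q PQ]]] := @dF (crossA i (f z) (g z), g z).
  by split => //=; exact/discE.
apply/derivable_cderivP; exists (P * a' + Q * g').
exact: (@cderiv_chain2 _ (fun w => (F w).2) (fun z => crossA i (f z) (g z))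
  g z P Q a' g' PQ a'P g'P).
Qed.

(** * Contraction of the cross form, and orbits with given symbols *)

Local Notation kap := (pick_const r).

Lemma cross_contraction i (k : R) x x' y y' : 0 < k -> k < 1 ->
  cabs x < 1 -> cabs x' < 1 -> cabs y < 1 -> cabs y' < 1 ->
  phdist_le k x x' -> phdist_le k y y' ->
  phdist_le (kap * k) (crossA i x y) (crossA i x' y') /\
  phdist_le (kap * k) (crossB i x y) (crossB i x' y').
Proof.
move=> k0 k1 x1 x1' y1 y1' xx yy; split; apply: phdist_contraction => //.
- by move=> u v /discE u1 /discE v1; exact: (cross_lt i u1 v1).1.
- by move=> f g fg; exact: derivable_crossA.
- by move=> u v /discE u1 /discE v1; exact: (cross_lt i u1 v1).2.
- by move=> f g fg; exact: derivable_crossB.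
Qed.

(** p and q are r times points of D, whose pseudo-hyperbolic distance is at most 1. *)
Lemma phdist_small p q : cabs p < r -> cabs q < r -> phdist_le kap p q.
Proof.
move=> pr qr; have r0' : RtoC r != 0 by rewrite -cabs_gt0 cabs_RtoC normr_gt0 lt0r_neq0.
have sc x : cabs x < r -> cabs ((RtoC r)^-1 * x) < 1.
  by move=> xr; rewrite cabsM cabsV cabs_RtoC gtr0_norm// mulrC ltr_pdivrMr// mul1r.
have := @phdist_scale R r 1 ((RtoC r)^-1 * p) ((RtoC r)^-1 * q) r_gt0 r_lt1 ler01
  (ltW (sc p pr)) (ltW (sc q qr)).
rewrite mulr1 !mulVKf//; apply.
by rewrite /phdist_le mul1r cabsC; apply: mobius_le; rewrite ?sc// ltW ?sc.
Qed.

Lemma phdist_le2 (k : R) p q : 0 <= k -> cabs p < 1 -> cabs q < 1 ->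
  phdist_le k p q -> cabs (p - q) <= 2 * k.
Proof.
move=> k0 p1 q1 h; apply: (le_trans h); rewrite mulrC ler_wpM2r//.
have := cabsB 1 (cconj p * q); rewrite cabs1 cabsM cabs_cconj.
have : cabs p * cabs q <= 1 by rewrite mulr_ile1 ?cabs_ge0// ltW.
by lra.
Qed.

Definition is_orbit (p : int -> C * C) :=
  forall n, B (p n) /\ F (p n) = p (n + 1).

Lemma orbit_cross p n : is_orbit p ->
  (p n).1 = crossA (lab (p (n + 1))) (p (n + 1)).1 (p n).2 /\
  (p (n + 1)).2 = crossB (lab (p (n + 1))) (p (n + 1)).1 (p n).2.
Proof.
move=> op; have [[x1 y1] Fp] := op n; have [Bp1 _] := op (n + 1).
have [x1' _] := Bp1.
have st : crossing (lab (p (n + 1))) (p (n + 1)).1 (p n).2 (p n).1.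
  by split; rewrite // -surjective_pairing Fp.
have E := crossA_unique x1' y1 st; split => //.
by rewrite /crossB -E -surjective_pairing Fp.
Qed.

(** The abscissa is bounded because F (p n) lies in B, the ordinate because p n = F (p (n - 1)). *)
Lemma orbit_lt p n : is_orbit p -> cabs (p n).1 < r /\ cabs (p n).2 < r.
Proof.
move=> op; have [Bn En] := op n; have [Bn1 _] := op (n + 1).
have [Bm Em] := op (n - 1); rewrite subrK in Em.
split; first by have [||] := r_bound (z := p n); rewrite ?En; try exact: bidisc_closed.
by rewrite -Em; have [||] := r_bound (z := p (n - 1)); rewrite ?Em; try exact: bidisc_closed.
Qed.

Lemma kap_pow_gt0 n : 0 < kap ^+ n.
Proof. by rewrite exprn_gt0// pick_const_gt0. Qed.

Lemma kap_pow_lt1 n : kap ^+ n.+1 < 1.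
Proof.
by rewrite exprn_ilt1// ?pick_const_lt1// ltW// pick_const_gt0.
Qed.

(** Each use of the cross form shrinks the window of agreement by one and gains a factor [kap]. The
    base case gains the first factor by [phdist_small], whence the exponent k + 1. *)
Lemma orbits_close p q (N k : nat) : is_orbit p -> is_orbit q ->
  (forall n : int, (`|n| <= N)%N -> lab (p n) = lab (q n)) ->
  forall n : int, (`|n| + k <= N)%N ->
  phdist_le (kap ^+ k.+1) (p n).1 (q n).1 /\
  phdist_le (kap ^+ k.+1) (p n).2 (q n).2.
Proof.
move=> op oq pq; have lt1 x : cabs x < r -> cabs x < 1.
  by move=> h; exact: lt_trans r_lt1.
elim: k => [|k IH] n nk; last first.
  have n0 : (`|n| <= N)%N by lia.
  have n1 : (`|(n + 1)%R| <= N)%N by lia.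
  have nk0 : (`|n| + k <= N)%N by lia.
  have nk1 : (`|(n + 1)%R| + k <= N)%N by lia.
  have nk2 : (`|(n - 1)%R| + k <= N)%N by lia.
  have [pA _] := orbit_cross n op; have [qA _] := orbit_cross n oq.
  have [_ pB] := orbit_cross (n - 1) op; have [_ qB] := orbit_cross (n - 1) oq.
  rewrite subrK in pB qB.
  have [h1 h1'] := IH _ nk1; have [h2 h2'] := IH _ nk0.
  have [h3 h3'] := IH _ nk2.
  have [p1 p2] := orbit_lt n op; have [q1 q2] := orbit_lt n oq.
  have [p3 p4] := orbit_lt (n + 1) op; have [q3 q4] := orbit_lt (n + 1) oq.
  have [p5 p6] := orbit_lt (n - 1) op; have [q5 q6] := orbit_lt (n - 1) oq.
  rewrite (pq _ n1) in pA; rewrite (pq _ n0) in pB; rewrite exprS; split.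
    have [+ _] := cross_contraction (lab (q (n + 1)))
      (kap_pow_gt0 k.+1) (kap_pow_lt1 k) (lt1 _ p3) (lt1 _ q3) (lt1 _ p2)
      (lt1 _ q2) h1 h2'.
    by rewrite -pA -qA.
  have [_] := cross_contraction (lab (q n))
      (kap_pow_gt0 k.+1) (kap_pow_lt1 k) (lt1 _ p1) (lt1 _ q1) (lt1 _ p6)
      (lt1 _ q6) h2 h3'.
  by rewrite -pB -qB.
have [p1 p2] := orbit_lt n op; have [q1 q2] := orbit_lt n oq.
by rewrite expr1; split; exact: phdist_small.
Qed.

(** On the disc of radius r the denominator |1 - conj p q| is at least 1 - r^2. *)
Lemma phdist_of_dist (e : R) p q : 0 <= e -> cabs p <= r -> cabs q <= r ->
  cabs (p - q) <= e * (1 - r ^+ 2) -> phdist_le e p q.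
Proof.
move=> e0 pr qr h; apply: (le_trans h); rewrite ler_wpM2l//.
have := cabs_sub_ge 1 (cconj p * q); rewrite cabs1 cabsM cabs_cconj.
have : cabs p * cabs q <= r * r by apply: ler_pM => //; exact: cabs_ge0.
by rewrite expr2; lra.
Qed.

(** An orbit with symbols s is a fixed point of T on bi-infinite sequences; the iterates of the zero
    sequence converge geometrically, at a rate independent of n. *)
Lemma orbit_exists (s : int -> 'I_d) :
  exists p, is_orbit p /\ forall n, lab (p n) = s n.
Proof.
pose T (q : int -> C * C) (n : int) : C * C :=
  (crossA (s (n + 1)) (q (n + 1)).1 (q n).2,
   crossB (s n) (q n).1 (q (n - 1)).2).
pose q k := iter k T (fun=> (0, 0)).
have lt1 x : cabs x < r -> cabs x < 1 by move=> h; exact: lt_trans r_lt1.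
have T_lt p : (forall n, cabs (p n).1 < 1 /\ cabs (p n).2 < 1) ->
    forall n, cabs (T p n).1 < r /\ cabs (T p n).2 < r.
  move=> p1 n; have D m : disc (p m).1 /\ disc (p m).2.
    by have [a b] := p1 m; split; exact/discE.
  split; first exact: (cross_lt _ (D _).1 (D _).2).1.
  exact: (cross_lt _ (D _).1 (D _).2).2.
have q_lt k : forall n, cabs (q k n).1 < r /\ cabs (q k n).2 < r.
  elim: k => [n|k IH]; first by rewrite /q /= cabs0.
  by apply: T_lt => n; have [a b] := IH n; split; exact: lt1.
have T_contr p p' (k : R) : 0 < k -> k < 1 ->
   (forall n, cabs (p n).1 < 1 /\ cabs (p n).2 < 1) ->
   (forall n, cabs (p' n).1 < 1 /\ cabs (p' n).2 < 1) ->
   (forall n, phdist_le k (p n).1 (p' n).1 /\ phdist_le k (p n).2 (p' n).2) ->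
   forall n, phdist_le (kap * k) (T p n).1 (T p' n).1 /\
             phdist_le (kap * k) (T p n).2 (T p' n).2.
  move=> k0 k1 p1 p1' pp n.
  have [a1 a2] := p1 (n + 1); have [b1 b2] := p1 n; have [c1 c2] := p1 (n - 1).
  have [a1' a2'] := p1' (n + 1); have [b1' b2'] := p1' n.
  have [c1' c2'] := p1' (n - 1).
  have [h1 _] := pp (n + 1); have [h2 h2'] := pp n; have [_ h3] := pp (n - 1).
  split; first exact: (cross_contraction _ k0 k1 a1 a1' b2 b2' h1 h2').1.
  exact: (cross_contraction _ k0 k1 b1 b1' c2 c2' h2 h3).2.
have q_lt1 k n : cabs (q k n).1 < 1 /\ cabs (q k n).2 < 1.
  by have [a b] := q_lt k n; split; exact: lt1.
have q_close k : forall n, phdist_le (kap ^+ k.+1) (q k n).1 (q k.+1 n).1 /\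
    phdist_le (kap ^+ k.+1) (q k n).2 (q k.+1 n).2.
  elim: k => [n|k IH].
    have [a1 a2] := q_lt 0%N n; have [b1 b2] := q_lt 1%N n.
    by rewrite expr1; split; exact: phdist_small.
  move=> n; rewrite exprS; exact: (T_contr (q k) (q k.+1) _ (kap_pow_gt0 k.+1)
    (kap_pow_lt1 k) (q_lt1 k) (q_lt1 k.+1) IH n).
have kap0 : 0 < kap := pick_const_gt0 r_gt0.
have kap1 : kap < 1 := pick_const_lt1 r_gt0 r_lt1.
have dist2 u v k : phdist_le (kap ^+ k.+1) u v -> cabs u < 1 -> cabs v < 1 ->
    cabs (v - u) <= 2 * kap * kap ^+ k.
  move=> h u1 v1; rewrite cabsC -mulrA -exprS.
  by apply: phdist_le2 => //; exact/ltW/kap_pow_gt0.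
pose eta k := 2 * (2 * kap / (1 - kap) * kap ^+ k).
have k20 : 0 <= 2 * kap by rewrite mulr_ge0// ltW.
have /choice[p pP] : forall n, exists p : C * C, forall k,
    cabs ((q k n).1 - p.1) <= eta k /\ cabs ((q k n).2 - p.2) <= eta k.
  move=> n; have [|a Ha] := geometric_limit (u := fun k => (q k n).1) k20 (ltW kap0) kap1.
    move=> k; have [h _] := q_close k n.
    exact: dist2 h (q_lt1 k n).1 (q_lt1 k.+1 n).1.
  have [|b Hb] := geometric_limit (u := fun k => (q k n).2) k20 (ltW kap0) kap1.
    move=> k; have [_ h] := q_close k n.
    exact: dist2 h (q_lt1 k n).2 (q_lt1 k.+1 n).2.
  by exists (a, b).
have K0 : 0 < 4 * kap / (1 - kap) by apply: divr_gt0; [exact: mulr_gt0|rewrite subr_gt0].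
have eta_small (e : R) : 0 < e -> exists k, eta k <= e.
  move=> e0; have [k Hk] := exists_exp_lt (ltW kap0) kap1 (divr_gt0 e0 K0).
  exists k; move: Hk; rewrite ltr_pdivlMr// => /ltW; apply: le_trans.
  by rewrite le_eqVlt; apply/orP; left; apply/eqP; rewrite /eta; ring.
have p_le n : cabs (p n).1 <= r /\ cabs (p n).2 <= r.
  split; apply/ler_addgt0Pr => e /eta_small[k ke].
    have [h _] := pP n k; have [h' _] := q_lt k n.
    have := cabsD ((p n).1 - (q k n).1) (q k n).1; rewrite subrK cabsC.
    by lra.
  have [_ h] := pP n k; have [_ h'] := q_lt k n.
  have := cabsD ((p n).2 - (q k n).2) (q k n).2; rewrite subrK cabsC.
  by lra.
have p_lt1 n : cabs (p n).1 < 1 /\ cabs (p n).2 < 1.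
  by have [a b] := p_le n; split; exact: le_lt_trans r_lt1.
have r2 : 0 < 1 - r ^+ 2 by rewrite subr_gt0 expr_lt1// ltW.
(* The limit p is a fixed point: in each coordinate it is within e of q k.+1 = T (q k), which by
   contraction is within 2 e of T p. *)
have Tp (e : R) : 0 < e -> e < 1 -> forall n,
    cabs ((p n).1 - (T p n).1) <= 3 * e /\ cabs ((p n).2 - (T p n).2) <= 3 * e.
  move=> e0 e1 n; have [k ke] := eta_small (e * (1 - r ^+ 2)) (mulr_gt0 e0 r2).
  have ke' : eta k.+1 <= e.
    have : eta k.+1 <= eta k.
      rewrite /eta exprS; apply: ler_wpM2l => //; apply: ler_wpM2l.
        by rewrite divr_ge0// subr_ge0 ltW.
      by rewrite ler_piMl ?(ltW kap1)// ltW// exprn_gt0.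
    move/le_trans; apply; apply: (le_trans ke).
    by rewrite ler_piMr ?(ltW e0)// lerBlDr lerDl sqr_ge0.
  have near m : phdist_le e (q k m).1 (p m).1 /\ phdist_le e (q k m).2 (p m).2.
    have [a b] := pP m k; have [pa pb] := p_le m; have [qa qb] := q_lt k m.
    split; (apply: phdist_of_dist; [exact: ltW|exact: ltW|by []|]).
      exact: le_trans a ke.
    exact: le_trans b ke.
  have [c1 c2] := T_contr _ _ e e0 e1 (q_lt1 k) p_lt1 near n.
  have [t1 t2] := T_lt _ p_lt1 n; have [a b] := pP n k.+1.
  have [u1 u2] := q_lt1 k.+1 n.
  have ke0 : 0 <= kap * e by rewrite mulr_ge0// ltW.
  have ke1 : kap * e <= e by rewrite ler_piMl ?(ltW e0)// ltW.
  have d1 := phdist_le2 ke0 u1 (lt1 _ t1) c1.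
  have d2 := phdist_le2 ke0 u2 (lt1 _ t2) c2.
  split.
    have := cabsD ((p n).1 - (q k.+1 n).1) ((q k.+1 n).1 - (T p n).1).
    by rewrite addrA subrK [cabs ((p n).1 - (q k.+1 n).1)]cabsC; lra.
  have := cabsD ((p n).2 - (q k.+1 n).2) ((q k.+1 n).2 - (T p n).2).
  by rewrite addrA subrK [cabs ((p n).2 - (q k.+1 n).2)]cabsC; lra.
have zero (x : R) : 0 <= x -> (forall e : R, 0 < e -> e < 1 -> x <= 3 * e) -> x = 0.
  move=> x0 H; apply/eqP; rewrite eq_le x0 andbT leNgt; apply/negP => xp.
  have := H (Num.min (x / 6) (1 / 2)).
  have m0 : 0 < Num.min (x / 6) (1 / 2) by rewrite lt_min !divr_gt0.
  have m1 : Num.min (x / 6) (1 / 2) <= x / 6 by rewrite ge_min lexx.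
  have m2 : Num.min (x / 6) (1 / 2) <= 1 / 2 by rewrite ge_min lexx orbT.
  move: m0 m1 m2; set m := Num.min _ _ => m0 m1 m2 /(_ m0).
  have m3 : m < 1 by lra.
  by move=> /(_ m3); lra.
have Tp1 n : (p n).1 = (T p n).1.
  apply/eqP; rewrite -subr_eq0 -cabs_eq0; apply/eqP/zero; first exact: cabs_ge0.
  by move=> e e0 e1; have [] := Tp e e0 e1 n.
have Tp2 n : (p n).2 = (T p n).2.
  apply/eqP; rewrite -subr_eq0 -cabs_eq0; apply/eqP/zero; first exact: cabs_ge0.
  by move=> e e0 e1; have [] := Tp e e0 e1 n.
(* The fixed point equation at n gives the abscissa of the crossing; the one at n + 1 gives the
   ordinate of its image. *)
have step n : [/\ B (p n), F (p n) = p (n + 1) & lab (p (n + 1)) = s (n + 1)].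
  have D m : disc (p m).1 /\ disc (p m).2.
    by have [a b] := p_lt1 m; split; exact/discE.
  have [x1 BF labF F1] := crossAP (s (n + 1)) (D (n + 1)).1 (D n).2.
  have F2 : (F (crossA (s (n + 1)) (p (n + 1)).1 (p n).2, (p n).2)).2 =
     (p (n + 1)).2 by rewrite [RHS]Tp2 /= addrK.
  move: BF labF F1 F2; have -> : crossA (s (n + 1)) (p (n + 1)).1 (p n).2 = (p n).1.
    by rewrite [RHS]Tp1.
  rewrite -surjective_pairing => BF labF F1 F2.
  have FE : F (p n) = p (n + 1) by rewrite [LHS]surjective_pairing F1 F2 -surjective_pairing.
  by split; [exact: D n|exact: FE|rewrite -labF FE].
exists p; split; first by move=> n; have [] := step n.
by move=> n; have [_ _] := step (n - 1); rewrite subrK.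
Qed.

(** * The itinerary map and its inverse *)

Definition orb z (n : int) : C * C :=
  match n with Posz m => iter m F z | Negz m => iter m.+1 G z end.

Lemma orb_orbit z : K_inv F G z -> is_orbit (orb z).
Proof.
move=> [[Bz FB] [_ GB]].
have BF m : B (iter m F z) by case: m => [//|m]; exact: FB.
have BG m : B (iter m G z) by case: m => [//|m]; exact: GB.
case=> m; split; [exact: BF| |exact: BG|].
  by have -> : Posz m + 1 = Posz m.+1 by lia.
have -> : Negz m + 1 = - Posz m by lia.
rewrite /orb iterS FG; [|exact: bidisc_closed|exact: bidisc_closed (BG m.+1)].
case: m => [//|m].
by have -> : - Posz m.+1 = Negz m by lia.
Qed.

Lemma orbit_iterF p n m : is_orbit p -> iter m F (p n) = p (n + Posz m).
Proof.
move=> op; elim: m => [|m IH]; first by rewrite addr0.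
by rewrite iterS IH (op _).2; congr p; lia.
Qed.

Lemma orbit_iterG p n m : is_orbit p -> iter m G (p n) = p (n - Posz m).
Proof.
move=> op; elim: m => [|m IH]; first by rewrite subr0.
rewrite iterS IH; have [Bm Em] := op (n - Posz m.+1).
have E : n - Posz m.+1 + 1 = n - Posz m by lia.
rewrite E in Em; rewrite -Em GF//; first exact: bidisc_closed.
by rewrite Em; exact/bidisc_closed/(op _).1.
Qed.

Lemma orbit_orb p n : is_orbit p -> orb (p 0) n = p n.
Proof.
move=> op; case: n => m; first by rewrite /orb orbit_iterF// add0r.
by rewrite /orb orbit_iterG// sub0r; congr p; lia.
Qed.

Lemma orbit_K p : is_orbit p -> K_inv F G (p 0).
Proof.
move=> op; split; split; try exact: (op _).1.
  by move=> n _; rewrite orbit_iterF//; exact: (op _).1.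
by move=> n _; rewrite orbit_iterG//; exact: (op _).1.
Qed.

Lemma orbit_shift p : is_orbit p -> is_orbit (fun n => p (n + 1)).
Proof. by move=> op n; exact: op. Qed.

Lemma orbits_dist p q N : is_orbit p -> is_orbit q ->
  (forall n : int, (`|n| <= N)%N -> lab (p n) = lab (q n)) ->
  cabs ((p 0).1 - (q 0).1) <= 2 * kap ^+ N.+1 /\
  cabs ((p 0).2 - (q 0).2) <= 2 * kap ^+ N.+1.
Proof.
move=> op oq pq; have [|h1 h2] := @orbits_close p q N N op oq pq 0.
  by rewrite absz0.
have [p1 p2] := orbit_lt 0 op; have [q1 q2] := orbit_lt 0 oq.
have k0 := ltW (kap_pow_gt0 N.+1).
by split; apply: phdist_le2 => //; exact: lt_trans r_lt1.
Qed.

Lemma exists_kap_small (e : R) : 0 < e -> exists N, 2 * kap ^+ N.+1 < e.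
Proof.
move=> e0; have kap0 := pick_const_gt0 r_gt0.
have kap1 := pick_const_lt1 r_gt0 r_lt1.
have [N HN] := exists_exp_lt (ltW kap0) kap1 (divr_gt0 e0 (ltr0Sn R 1)).
exists N; rewrite mulrC -ltr_pdivlMr//; apply: le_lt_trans HN.
by rewrite exprS ler_piMl ?(ltW kap1)// exprn_ge0// ltW.
Qed.

Lemma orbits_eq p q : is_orbit p -> is_orbit q ->
  (forall n, lab (p n) = lab (q n)) -> p 0 = q 0.
Proof.
move=> op oq pq.
have Z (x : C) : (forall N, cabs x <= 2 * kap ^+ N.+1) -> x = 0.
  move=> H; apply/eqP; rewrite -cabs_eq0 eq_le cabs_ge0 andbT leNgt.
  apply/negP => /exists_kap_small[N]; rewrite ltNge; apply/negP; rewrite negbK.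
  exact: H.
have D N := @orbits_dist p q N op oq (fun n _ => pq n).
rewrite (surjective_pairing (p 0)) (surjective_pairing (q 0)).
by congr (_, _); apply/eqP; rewrite -subr_eq0; apply/eqP/Z => N;
  have [] := D N.
Qed.

(** Continuity is relative to points whose forward orbit stays in B, since H is controlled only on
    the closed bidisc. *)
Lemma iter_cont (H : C * C -> C * C) m z : cont_on cB H ->
  (forall i, B (iter i H z)) -> forall e : R, 0 < e ->
  exists2 de : R, 0 < de & forall w, (forall i, B (iter i H w)) ->
    polyclose de z w -> polyclose e (iter m H z) (iter m H w).
Proof.
move=> cH Bz; elim: m => [|m IH] e e0; first by exists e.
have [d1 d10 H1] := cH _ (bidisc_closed (Bz m)) e e0.
have [d2 d20 H2] := IH d1 d10.
exists d2 => // w Bw wd; rewrite !iterS; apply: H1; last exact: H2.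
exact/bidisc_closed/Bw.
Qed.

Lemma orb_cont n z : K_inv F G z -> forall e : R, 0 < e ->
  exists2 de : R, 0 < de & forall w, K_inv F G w ->
    polyclose de z w -> polyclose e (orb z n) (orb w n).
Proof.
have BF w : K_inv F G w -> forall i, B (iter i F w).
  by move=> [[Bz FB] _] [//|m]; exact: FB.
have BG w : K_inv F G w -> forall i, B (iter i G w).
  by move=> [_ [Bz GB]] [//|m]; exact: GB.
move=> Kz e e0; case: n => m.
  have [de de0 H] := iter_cont m cF (BF z Kz) e0.
  by exists de => // w Kw; apply: H; exact: BF.
have [de de0 H] := iter_cont m.+1 cG (BG z Kz) e0.
by exists de => // w Kw; apply: H; exact: BG.
Qed.

Definition itinerary z : symbol_space d := fun n => lab (orb z n).

(** The product topology reduces the claim to one coordinate n, where the label is locally constant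
    because [orb z n] and its preimage under F both lie in B. *)
Lemma itinerary_cont : {within K_inv F G, continuous itinerary}.
Proof.
apply/subspace_continuousP => z Kz; apply/cvg_sup => n U [V] [[W] oW <-] Wn WU.
apply: (filterS WU) => /=.
have oz := orb_orbit Kz.
have Bn m : B (orb z m) := (oz m).1.
have BG : B (G (orb z n)).
  have E := (oz (n - 1)).2; rewrite subrK in E.
  by rewrite -E GF//; [exact: bidisc_closed|rewrite E; exact: bidisc_closed].
have [e e0 He] := lab_loc (Bn n) BG.
have [de de0 Hd] := orb_cont n Kz e0.
have : nbhs z [set w | K_inv F G w -> W (itinerary w n)]; last exact.
apply/nbhs_closeP; exists de => // w wd Kw.
have ow := orb_orbit Kw.
rewrite /itinerary (He (orb w n)); [exact: Wn|exact: (ow n).1| |exact: Hd].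
have E := (ow (n - 1)).2; rewrite subrK in E.
rewrite -E GF//; first exact: (ow _).1.
  exact/bidisc_closed/(ow _).1.
by rewrite E; exact/bidisc_closed/(ow _).1.
Qed.

(** Cylinders over finitely many coordinates are neighbourhoods; the induction adds the coordinates
    N + 1 and -(N + 1). *)
Lemma nbhs_symbols (s : symbol_space d) (N : nat) :
  \forall t \near s, forall n : int, (`|n| <= N)%N -> t n = s n.
Proof.
have one (n : int) : \forall t \near s, t n = s n.
  have : nbhs (proj n s) [set s n].
    by rewrite nbhs_principalE; exact/principal_filterP.
  by move=> /(@proj_continuous int (fun=> discrete_topology 'I_d) n s).
elim: N => [|N IH].
  near=> t => n n0; have -> : n = 0 by lia.
  by near: t; exact: one.
near=> t => n nN.
have [h|h] := leqP `|n| N; first by move: n h {nN}; near: t.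
have [->|->] : n = Posz N.+1 \/ n = - Posz N.+1 by lia.
  by near: t; exact: one.
by near: t; exact: one.
Unshelve. all: by end_near. Qed.

(** The inverse sends s to the time-0 point of the orbit with symbols s. Injectivity comes from
    [orbits_eq], continuity of the inverse from [orbits_dist], and the conjugacy from the fact that
    F z has the shifted orbit of z. *)
Lemma horseshoe_core_aux :
  [/\ homeomorphism (K_inv F G) setT itinerary,
      (forall z, K_inv F G z -> K_inv F G (F z)) &
      (forall z, K_inv F G z -> itinerary (F z) = full_shift (itinerary z))].
Proof.
have orbF z : K_inv F G z -> F z = orb z (0 + 1) by [].
split.
- have /choice[P PP] := orbit_exists.
  exists (fun s : symbol_space d => P s 0).
  have PO s : is_orbit (P s) := (PP s).1.
  have PL s n : lab (P s n) = s n := (PP s).2 n.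
  split.
  + exact: itinerary_cont.
  + apply/subspace_continuousP => s _; apply: cvg_within_filter.
    move=> A /nbhs_closeP[e e0 eA].
    have [N HN] := exists_kap_small e0.
    have := nbhs_symbols s N; apply: filterS => t ts /=; apply: eA.
    have [h1 h2] : cabs ((P t 0).1 - (P s 0).1) <= 2 * kap ^+ N.+1 /\
        cabs ((P t 0).2 - (P s 0).2) <= 2 * kap ^+ N.+1.
      by apply: orbits_dist => // n nN; rewrite !PL; exact: ts.
    by split; exact: le_lt_trans HN.
  + move=> z Kz; split => //.
    have -> : z = orb z 0 by [].
    by apply: orbits_eq => //; [exact: orb_orbit|move=> n; rewrite PL].
  + move=> s _; split; first exact: orbit_K.
    by apply/funext => n; rewrite /itinerary orbit_orb// PL.
- move=> z Kz; rewrite orbF//.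
  exact: (orbit_K (orbit_shift (orb_orbit Kz))).
- move=> z Kz; apply/funext => n; rewrite /itinerary /full_shift; congr lab.
  rewrite (orbF z Kz).
  exact: (orbit_orb n (orbit_shift (orb_orbit Kz))).
Qed.

End Horseshoe.

(** * Labels from the fibrations, and the vertical case *)

Section Final.
Variable R : realType.
Local Notation C := (Cplx R).
Local Notation B := (@bidisc R).
Local Notation cB := (@closed_bidisc R).
Implicit Types (F G : C * C -> C * C).

Definition coded d F G :=
  exists Phi : C * C -> symbol_space d,
    [/\ homeomorphism (K_inv F G) setT Phi,
        (forall z, K_inv F G z -> K_inv F G (F z)) &
        (forall z, K_inv F G z -> Phi (F z) = full_shift (Phi z))].

(** The parameter q is [snd] for horizontal maps and [fst] for vertical ones. Only values of the
    label on B n F(B) are constrained. *)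
Definition labelling d F G (q : C * C -> C) (lab : C * C -> 'I_d) :=
  (forall w, B w -> B (G w) -> exists2 e : R, 0 < e &
     forall w', B w' -> B (G w') -> polyclose e w w' -> lab w' = lab w) /\
  (forall i y, disc y -> exists z, [/\ B z, B (F z), lab (F z) = i & q z = y]).

Lemma horizontal_coded d F G (lab : C * C -> 'I_d) :
  (forall z, cB z -> cB (G z) -> F (G z) = z) ->
  (forall z, cB z -> cB (F z) -> G (F z) = z) ->
  cont_on cB F -> cont_on cB G ->
  (forall z, B z ->
    (exists P Q, has_diff2 (fun w => (F w).1) z P Q) /\
    (exists P Q, has_diff2 (fun w => (F w).2) z P Q)) ->
  horizontal F ->
  (forall y, disc y ->
    fibers_count (fun t => (F (t, y)).1) [set t | disc t /\ B (F (t, y))] d) ->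
  labelling F G snd lab -> coded d F G.
Proof.
move=> FG GF cF cG dF hF fib [loc full].
have [r /andP[r0 r1] rb] := crossing_bound cF hF.
have lab_full i y : disc y ->
    exists t, [/\ disc t, B (F (t, y)) & lab (F (t, y)) = i].
  move=> /(full i)[[t y'] [[t1 _] BF labF <-]].
  by exists t.
by exists (itinerary F G lab); apply: (horseshoe_core_aux FG GF cF cG dF fib loc lab_full r0 r1 rb).
Qed.

Lemma iter_images1 F G w : (forall z, cB z -> cB (G z) -> F (G z) = z) ->
  (forall z, cB z -> cB (F z) -> G (F z) = z) ->
  iter_images F 1 w <-> B w /\ B (G w).
Proof.
move=> FG GF; split=> [H|[Bw BG] m /=].
  have [z [Bz _ /= zw]] := H 0%N isT; rewrite zw in Bz.
  have [v [Bv _ /= vw]] := H 1%N isT.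
  split=> //; rewrite -vw GF//; first exact: bidisc_closed.
  by rewrite vw; exact: bidisc_closed.
case: m => [_|[_|//]]; first by exists w.
exists (G w); split=> //=.
  by case=> // _; exact: bidisc_closed.
by apply: FG; exact: bidisc_closed.
Qed.

(** The label of a point of B n F(B) is the number of its sheet. To reach sheet i from a point with
    q = y, some p0 of that sheet is pulled back by G and moved inside one sheet of B n G(B); the
    label of the image is locally constant along the way, hence constant. *)
Lemma labelling_exists d F G (p q : C * C -> C) :
  (forall z, cB z -> cB (G z) -> F (G z) = z) ->
  (forall z, cB z -> cB (F z) -> G (F z) = z) ->
  cont_on cB F ->
  trivial_fibration (iter_images F 1) (@disc R) p (@disjoint_discs R (d ^ 1)) ->
  trivial_fibration (iter_images G 1) (@disc R) q (@disjoint_discs R (d ^ 1)) ->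
  exists lab : C * C -> 'I_d, labelling F G q lab.
Proof.
move=> FG GF cF [h [[hi [ch chi hK hiK]] hp]] [k [[ki [ck cki kK kiK]] kp]].
have XE w := @iter_images1 F G w FG GF.
have YE w := @iter_images1 G F w GF FG.
pose lab0 w : 'I_(d ^ 1) := (h w).2.1.
have loc w : B w -> B (G w) -> exists2 e : R, 0 < e &
    forall w', B w' -> B (G w') -> polyclose e w w' -> lab0 w' = lab0 w.
  move=> Bw BG; move/subspace_continuousP: ch => /(_ w ((XE w).2 (conj Bw BG))) cw.
  have : nbhs (h w) [set v | v.2.1 = (h w).2.1].
    exists (setT, [set u | u.1 = (h w).2.1]).
      split; first exact: filterT.
      exists ([set (h w).2.1], setT).
        split; last exact: filterT.
        by rewrite nbhs_principalE; exact/principal_filterP.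
      by move=> [a b] [/= -> _].
    by move=> [a b] [_ /=].
  move=> /cw hw.
  have : nbhs w [set v | iter_images F 1 v -> (h v).2.1 = (h w).2.1] by exact: hw.
  move=> /nbhs_closeP[e e0 H]; exists e => // w' Bw' BG' ww'.
  by apply: H => //; apply/XE.
exists (fun w => cast_ord (expn1 d) (lab0 w)); split.
  move=> w Bw BG; have [e e0 H] := loc w Bw BG.
  by exists e => // w' Bw' BG' /(H w' Bw' BG') ->.
move=> i y y1.
have disc0 : disc (0 : C) by apply/discE; rewrite cabs0.
pose i' := cast_ord (esym (expn1 d)) i.
pose p0 := hi (0, (i', 0)).
have [Xp0 hp0] : iter_images F 1 p0 /\ h p0 = (0, (i', 0)).
  by apply: hiK; split => //=; split.
have [Bp0 BGp0] := (XE p0).1 Xp0.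
have FGp0 : F (G p0) = p0 by apply: FG; exact: bidisc_closed.
have Yq0 : iter_images G 1 (G p0) by apply/YE; rewrite FGp0.
have [[k1 [_ k2]] kiq0] := kK _ Yq0.
(* In the chart k, a straight path to the base point y and the fibre coordinate 0, with the sheet
   number kept fixed. *)
pose c s := (seg (k (G p0)).1 y s, ((k (G p0)).2.1, seg (k (G p0)).2.2 0 s)).
have c_in s : 0 <= s <= 1 -> (@disc R `*` @disjoint_discs R (d ^ 1)) (c s).
  by move=> s01; split; [exact: seg_disc|split => //; exact: seg_disc].
have Yc s : 0 <= s <= 1 -> B (ki (c s)) /\ B (F (ki (c s))).
  by move=> /c_in/kiK[/YE].
have clab s : 0 <= s <= 1 -> exists2 e : R, 0 < e & forall u, 0 <= u <= 1 ->
    `|u - s| < e -> lab0 (F (ki (c u))) = lab0 (F (ki (c s))).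
  move=> s01; have [Bs BFs] := Yc s s01.
  have GFs : G (F (ki (c s))) = ki (c s) by apply: GF; exact: bidisc_closed.
  have [|e e0 He] := loc _ BFs; first by rewrite GFs.
  have [e1 e10 He1] := cF _ (bidisc_closed Bs) e e0.
  move/subspace_continuousP: cki => /(_ (c s) (c_in s s01)) cs.
  have : nbhs (ki (c s)) [set w | polyclose e1 (ki (c s)) w].
    by apply/nbhs_closeP; exists e1.
  move=> /cs hw.
  have : nbhs (c s) [set v | (@disc R `*` @disjoint_discs R (d ^ 1)) v ->
     polyclose e1 (ki (c s)) (ki v)] by exact: hw.
  move=> [[A1 A2] /= [/nbhs_cabsP[e2 e20 H2] [[A3 A4] /= [n3 /nbhs_cabsP[e4 e40 H4] s2]] s1]].
  have [d2 d20 Hd2] := seg_close (k (G p0)).1 y s e20.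
  have [d4 d40 Hd4] := seg_close (k (G p0)).2.2 0 s e40.
  exists (Num.min d2 d4); first by rewrite lt_min d20.
  move=> u u01; rewrite lt_min => /andP[/Hd2 u2 /Hd4 u4].
  have [Bu BFu] := Yc u u01.
  apply: He => //.
    by rewrite GF//; exact: bidisc_closed.
  apply: He1; first exact: bidisc_closed.
  apply: (s1 (c u)); last exact: c_in.
  split; first exact: H2.
  apply: (s2 ((k (G p0)).2.1, _)); split; last exact: H4.
  exact: (nbhs_singleton n3).
have c0 : ki (c 0) = G p0 by rewrite /c !seg_0 -!surjective_pairing.
exists (ki (c 1)).
have i01 : 0 <= (1 : R) <= 1 by rewrite ler01 lexx.
have [B1 BF1] := Yc 1 i01; split=> //.
  suff -> : lab0 (F (ki (c 1))) = i' by apply/val_inj.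
  apply: (@segment_induction R (fun s => lab0 (F (ki (c s))) = i')).
  - by rewrite c0 FGp0 /lab0 hp0.
  - by move=> s /clab[e e0 He] <-; exists e.
  - by move=> s /clab[e e0 He] ns; exists e => // u u01 /(He u u01) ->.
have [Y1 kc1] := kiK _ (c_in 1 i01).
by rewrite -kp// kc1 /c/= seg_1.
Qed.

(** * Exchanging the coordinates *)

Definition swap (z : C * C) : C * C := (z.2, z.1).

Lemma swapK : involutive swap. Proof. by case. Qed.

Lemma swap_bidisc z : B (swap z) <-> B z.
Proof. by split=> -[]. Qed.

Lemma swap_closed_bidisc z : cB (swap z) <-> cB z.
Proof. by split=> -[]. Qed.

Lemma swap_polyclose (e : R) z w : polyclose e z w -> polyclose e (swap z) (swap w).
Proof. by case. Qed.

Definition conj_swap F z := swap (F (swap z)).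

Lemma iter_conj_swap F n z : iter n (conj_swap F) z = swap (iter n F (swap z)).
Proof. by elim: n => [|n IH]; rewrite ?swapK// !iterS IH /conj_swap swapK. Qed.

Lemma conj_swap_cont F : cont_on cB F -> cont_on cB (conj_swap F).
Proof.
move=> cF z /swap_closed_bidisc cz e e0; have [d d0 H] := cF _ cz e e0.
exists d => // w /swap_closed_bidisc cw wd.
by apply: swap_polyclose; apply: H => //; exact: swap_polyclose.
Qed.

Lemma K_half_swap F z : K_half (conj_swap F) z <-> K_half F (swap z).
Proof.
by split=> -[/swap_bidisc Bz H]; split=> // n /H; rewrite iter_conj_swap => /swap_bidisc.
Qed.

Lemma K_inv_swap F G z :
  K_inv (conj_swap F) (conj_swap G) z <-> K_inv F G (swap z).
Proof. by split=> -[/K_half_swap h1 /K_half_swap h2]. Qed.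

Lemma has_diff2_swap (phi : C * C -> C) z (P Q : C) :
  has_diff2 phi (swap z) P Q -> has_diff2 (phi \o swap) z Q P.
Proof.
move=> H e e0; have [d d0 Hd] := H e e0; exists d => // w wd.
have := Hd (swap w) (swap_polyclose wd); rewrite /= [cabs (w.2 - z.2) + _]addrC.
by congr (cabs _ <= _); ring.
Qed.

Lemma coded_swap d F G : coded d (conj_swap F) (conj_swap G) -> coded d F G.
Proof.
move=> [Phi [[g [cPhi cg PhiK gK]] KF PhiF]].
have Ksw z : K_inv F G z -> K_inv (conj_swap F) (conj_swap G) (swap z).
  by move=> Kz; apply/K_inv_swap; rewrite swapK.
exists (Phi \o swap); split.
- exists (swap \o g); split.
  + apply/subspace_continuousP => z Kz A /= PA.
    move/subspace_continuousP: cPhi => /(_ _ (Ksw z Kz) A PA) hA.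
    have : nbhs (swap z) [set w | K_inv (conj_swap F) (conj_swap G) w -> A (Phi w)] by [].
    move=> /nbhs_closeP[e e0 H].
    have : nbhs z [set w | K_inv F G w -> A (Phi (swap w))]; last exact.
    apply/nbhs_closeP; exists e => // w wz Kw; apply: H; last exact: Ksw.
    exact: swap_polyclose.
  + apply/subspace_continuousP => s _ A /nbhs_closeP[e e0 eA].
    move/subspace_continuousP: cg => /(_ s I) cs.
    have nU : nbhs (g s) [set w | polyclose e (g s) w].
      by apply/nbhs_closeP; exists e.
    have cs' : nbhs s [set t | [set: symbol_space d] t -> polyclose e (g s) (g t)].
      exact: (cs _ nU).
    have : nbhs s [set t | [set: symbol_space d] t -> A (swap (g t))]; last exact.
    apply: filterS cs' => t ts tT; apply: eA.
    exact: swap_polyclose (ts tT).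
  + by move=> z Kz; split => //; have [_ /= ->] := PhiK _ (Ksw z Kz); rewrite swapK.
  + move=> s _; have [Kg gE] := gK s I; split; first exact/K_inv_swap.
    by rewrite /= swapK.
- move=> z Kz; have := KF _ (Ksw z Kz); rewrite /conj_swap swapK.
  by move=> /K_inv_swap; rewrite swapK.
- by move=> z Kz; have := PhiF _ (Ksw z Kz); rewrite /conj_swap swapK.
Qed.

Lemma vertical_conj_swap F : vertical F -> horizontal (conj_swap F).
Proof.
move=> [v1 v2]; split.
  apply/seteqP; split => // z [[w /swap_closed_bidisc cw <-] [b1 b2]].
  have : (F @` cB `&` @boundary_V R) (F (swap w)).
    by split; [exists (swap w)|split].
  by rewrite v2.
apply/seteqP; split => // z [cz [w [w1 w2] E]].
have : (cB `&` F @` @boundary_H R) (F (swap w)).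
  split; last by exists (swap w) => //; split.
  by rewrite -(swapK (F _)); apply/swap_closed_bidisc; rewrite -/(conj_swap F w) E.
by rewrite v1.
Qed.

End Final.

Theorem theorem3p1 (R : realType) (d : nat)
    (F G : Cplx R * Cplx R -> Cplx R * Cplx R)
    (hd : (2 <= d)%N) (hF : complex_horseshoe d F G) :
  exists Phi : Cplx R * Cplx R -> symbol_space d,
    [/\ homeomorphism (K_inv F G) setT Phi,
        (forall z, K_inv F G z -> K_inv F G (F z)) &
        (forall z, K_inv F G z -> Phi (F z) = full_shift (Phi z))].
Proof.
have [[_ [[_ wF dF] [_ wG _]] FG GF deg] fibr] := hF.
have cF := within_cont_on wF; have cG := within_cont_on wG.
have {}dF z : bidisc z -> _ := fun Bz => differentiable_diff2 (dF z Bz).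
have [hv_h hv_v] := fibr 1%N isT.
case: deg => -[hv slices].
  have [fF fG] := hv_h hv.
  have [lab labP] := labelling_exists FG GF cF fF fG.
  apply: (horizontal_coded FG GF cF cG dF hv _ labP) => y y1.
  by have [] := slices y y1.
have [fF fG] := hv_v hv.
(* Here the fibration of B n G(B) projects by [fst]; composing with [swap] turns this into the
   ordinate that [horizontal_coded] asks for. *)
have [lab [loc full]] := labelling_exists FG GF cF fF fG.
apply: coded_swap.
apply: (@horizontal_coded R d _ _ (lab \o @swap R)).
- move=> z /swap_closed_bidisc cz /swap_closed_bidisc.
  by rewrite /conj_swap !swapK => cGz; rewrite FG// swapK.
- move=> z /swap_closed_bidisc cz /swap_closed_bidisc.
  by rewrite /conj_swap !swapK => cGz; rewrite GF// swapK.
- exact: conj_swap_cont.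
- exact: conj_swap_cont.
- move=> z /swap_bidisc /dF[[P [Q PQ]] [P' [Q' PQ']]]; split.
    by exists Q', P'; exact: has_diff2_swap PQ'.
  by exists Q, P; exact: has_diff2_swap PQ.
- exact: vertical_conj_swap.
- move=> y y1; have [_ fc] := slices y y1; move=> w w1.
  have [s [e [us sP mP sm]]] := fc w w1; exists s, e; split => //.
  move=> x; rewrite sP /=; split=> -[[h1 h2] h3]; split=> //; split=> //.
    exact/swap_bidisc.
  exact/swap_bidisc.
- split=> [w Bw BG|i y y1].
    have [||e e0 H] := loc (swap w).
    + exact/swap_bidisc.
    + exact: (swap_bidisc _).1 BG.
    exists e => // w' Bw' BG' ww'; apply: H.
    + exact/swap_bidisc.
    + exact: (swap_bidisc _).1 BG'.
    exact: swap_polyclose.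
  have [z [Bz BF labF zy]] := full i y y1.
  exists (swap z); split; rewrite /conj_swap /= ?swapK//.
  + exact/swap_bidisc.
  + exact/swap_bidisc.
Qed.
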